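(* Let $p$ be a prime, let $G$ be a finite solvable group and let $\varphi \in \mathrm{IBr}(G)$ be an irreducible $p$-Brauer character of $G$. Then there exists $g \in G$ such that $o(g)=f_\varphi$.
   Context: $\mathrm{IBr}(G)$ denotes the set of irreducible ($p$-)Brauer characters of $G$; these are complex-valued functions defined on the set $G^0$ of $p$-regular elements of $G$ (elements whose order is not divisible by $p$). For a positive integer $n$, $\mathbb{Q}_n$ is the cyclotomic field obtained by adjoining a primitive $n$-th root of unity to $\mathbb{Q}$. The field of values of $\varphi$ is $\mathbb{Q}(\varphi)=\mathbb{Q}(\varphi(x)\mid x \in G^0)$, and the Feit number $f_\varphi$ is the smallest positive integer $n$ such that $\mathbb{Q}(\varphi)\subseteq\mathbb{Q}_n$. $o(g)$ denotes the order of $g$. *)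

(* Defs.v *)
From HB Require Import structures.
From mathcomp Require Import all_boot all_order all_fingroup all_algebra.
From mathcomp Require Import all_solvable all_field.
From mathcomp Require Import mxrepresentation.

Set Implicit Arguments.
Unset Strict Implicit.
Unset Printing Implicit Defensive.

Import GRing.Theory.
Local Open Scope ring_scope.

(* The ring of algebraic integers, as a type.  A residue field of it at a     *)
(* maximal ideal M containing p is given by a field F of characteristic p     *)
(* and a surjective morphism algint -> F, with kernel M.                      *)
Record algint := AlgInt { algint_val :> algC; algintP : algint_val \in Aint }.
HB.instance Definition _ := [isSub for algint_val].
HB.instance Definition _ := [Choice of algint by <:].
HB.instance Definition _ := [SubChoice_isSubComNzRing of algint by <:].

(* The set G^0 of p-regular elements of G. *)
Definition pregular (p : nat) (gT : finGroupType) (G : {set gT}) :=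
  {x : gT | (x \in G) && (p^'.-elt x)%g}.

(* For m = 0 the condition ~~ (p %| m) fails, so m is positive. *)
Definition pregular_root (p : nat) (z : algC) : Prop :=
  exists2 m : nat, ~~ (p %| m)%N & z ^+ m = 1.

Section BrauerCharacters.

Variables (p : nat) (F : fieldType) (red : {rmorphism algint -> F}).
Variables (gT : finGroupType) (G : {group gT}).

(* phi x is the sum of the unique lifts, to complex roots of unity of order   *)
(* prime to p, of the eigenvalues of rG x counted with multiplicity.          *)
Definition affords_Brauer (n : nat) (rG : mx_representation F G n)
    (phi : pregular p G -> algC) : Prop :=
  forall x : pregular p G, exists s : seq algint,
    [/\ {in s, forall z : algint, pregular_root p z},
        char_poly (rG (val x)) = \prod_(z <- s) ('X - (red z)%:P)
      & phi x = \sum_(z <- s) algint_val z].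

Definition IBr (phi : pregular p G -> algC) : Prop :=
  exists (n : nat) (rG : mx_representation F G n),
    mx_irreducible rG /\ affords_Brauer rG phi.

End BrauerCharacters.

(* The smallest subfield of the complex numbers containing S. *)
Definition Qadjoin (S : algC -> Prop) (x : algC) : Prop :=
  forall K : {pred algC},
    divring_closed K -> (forall y, S y -> y \in K) -> x \in K.

Definition cyclotomic_field (n : nat) (x : algC) : Prop :=
  exists2 z : algC, n.-primitive_root z & Qadjoin (fun y => y = z) x.

Definition field_of_values (T : Type) (phi : T -> algC) : algC -> Prop :=
  Qadjoin (fun y => exists x : T, y = phi x).

Definition values_in_cyclotomic (T : Type) (phi : T -> algC) (n : nat) : Prop :=
  forall y, field_of_values phi y -> cyclotomic_field n y.

Definition is_Feit_number (T : Type) (phi : T -> algC) (f : nat) : Prop :=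
  [/\ (0 < f)%N, values_in_cyclotomic phi f
    & forall n : nat, (0 < n)%N -> values_in_cyclotomic phi n -> (f <= n)%N].

(* Main.v *)
From HB Require Import structures.
Require Import Defs.
From mathcomp Require Import all_boot all_order all_fingroup all_algebra.
From mathcomp Require Import all_solvable all_field all_character.
From mathcomp Require Import ring.

Set Implicit Arguments.
Unset Strict Implicit.
Unset Printing Implicit Defensive.

Import Order.TTheory GroupScope GRing.Theory Num.Theory.
Local Open Scope ring_scope.

(**
Let k be prime to the order of G.  On the values of a character, replacing x
by x ^ k has the effect of the automorphism that raises the roots of unity of
order dividing the order of G to the power k.  The point is to find g in G
such that phi is unchanged whenever k = 1 modulo the order m of g.  By Galois
theory the values of phi then lie in the m-th cyclotomic field; as the a-th
and b-th cyclotomic fields meet in the (gcdn a b)-th one, the Feit number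
divides m, and some power of g has this order ([Feit_number_exists]).

Such a g is first found for a complex irreducible character chi
([Feit_irr]).  If the restriction of chi to some normal subgroup is not
homogeneous, then chi is induced from a proper inertia group, and induction
on the order of G applies, because field automorphisms commute with induction
of characters.  Otherwise, for every prime q, chi is the product of a
q-special and a q'-special character ([special_factor]), the values of which
are controlled by the q-elements and by the q'-elements respectively.
Invariance of chi can therefore be tested one prime at a time
([aut_part_fix]).  For each prime q that divides the conductor of chi, pick
an exponent k_q which is 1 modulo the q'-part of the order of G, which does
not preserve chi, and which fixes every element whose order misses the
required power of q.  The alternating sum over sets S of such primes of
the transforms of chi by the product of the k_q, q in S, has scalar product 1
with chi, hence is nonzero at some x; if the order of x missed the required
power of one q, then the terms with and without q would cancel.  So x is the
required element.

For a Brauer character, invariance is proved in the stronger form that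
rG (x ^ k) and rG x are similar for p-regular x ([Feit_similar]), by induction
on the dimension.  If the restriction of the module to a normal subgroup is
not homogeneous, the module is induced from the stabiliser of a homogeneous
component, and the similarities on this component spread to the whole module
([block_similar]).  Otherwise the module remains irreducible on a Hall
p'-subgroup Y ([Hall_irr]): along a chief series, a step which is a p-group
does not enlarge the linear span of the operators, since there are no
nontrivial p-power roots of unity in characteristic p
([p_quotient_envelop]).  On Y the module lifts to a complex irreducible
character with the same eigenvalue multiplicities ([irr_op_degree],
[rank_eig]), to which the first part applies.

It remains to go from matrices to phi: the lifts of the eigenvalues of rG x
to roots of unity of order prime to p are determined by the eigenvalues, so a
similarity between rG (x ^ k) and rG x means that raising to the power k
permutes the lifts ([char_poly_pow_stable]).  All this takes place over an
algebraically closed field, which the residue field of the ring of algebraic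
integers is ([residue_closed]).
*)

(** * Restriction to a supplement of a normal subgroup *)

Section ResSupplement.

Variables (gT : finGroupType) (M L P : {group gT}) (a : Iirr L).
Hypotheses (nsLM : L <| M) (sPM : P \subset M) (defM : (L * P)%g = M).
Hypotheses (IMa : M \subset 'I['chi_a])
           (irrPLa : 'Res[P :&: L] 'chi_a \in irr (P :&: L)%G).

Let Psi := 'Ind[M] 'chi_a.

Lemma cfnorm_Ind_invariant : '[Psi] = #|M : L|%:R.
Proof.
by rewrite -cfdot_Res_l cfRes_Ind_invariant // cfdotZl cfnorm_irr mulr1.
Qed.

(** Psi vanishes outside L and is a multiple of 'chi_a on L, so that its norm
on P is read on P :&: L, where 'chi_a has norm 1. *)
Lemma cfnorm_Res_Ind_supplement : '['Res[P] Psi] = #|M : L|%:R.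
Proof.
have sLM := normal_sub nsLM.
have DPsi x : x \in P -> Psi x = #|M : L|%:R * ('chi_a x *+ (x \in L)).
  move=> Px; have [Lx | L'x] := boolP (x \in L); last first.
    by rewrite mulr0n mulr0 (cfun_on0 (cfInd_normal _ nsLM)).
  have := cfRes_Ind_invariant nsLM IMa; move/cfunP/(_ x).
  by rewrite cfResE // cfunE.
have DiP : (#|M : L| = #|P : P :&: L|)%N.
  by rewrite indexgI -{1}defM indexMg.
rewrite cfdotE (eq_bigr (fun x => (#|M : L|%:R * #|M : L|%:R) *
   (if x \in L then 'chi_a x * ('chi_a x)^* else 0))) => [|x Px]; last first.
  rewrite cfResE // DPsi // rmorphM /= conjC_nat mulrACA.
  by case: (x \in L); rewrite ?mulr1n ?mulr0n ?mul0r.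
rewrite -mulr_sumr -big_mkcondr /=.
have cPL0: #|P :&: L|%:R != 0 :> algC by rewrite pnatr_eq0 -lt0n cardG_gt0.
have sPLP : P :&: L \subset P := subsetIl _ _.
set S := \sum_(i in _ | _) _; have DS : S = #|P :&: L|%:R.
  have /irrWnorm/(congr1 ( *%R #|P :&: L|%:R)) := irrPLa.
  rewrite mulr1 cfdotE mulVKf // => <-.
  apply: eq_big => x; first by rewrite inE.
  by move=> PLx; rewrite cfResE ?subsetIr // inE.
rewrite DS -(Lagrange sPLP) natrM.
have iMP0 : #|P : P :&: L|%:R != 0 :> algC by rewrite pnatr_eq0 -lt0n indexg_gt0.
by rewrite DiP; field; rewrite cPL0 iMP0.
Qed.

(** Restriction to P cannot decrease the scalar products of characters, and it
preserves the norm of Psi: it preserves all scalar products between the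
constituents of Psi. *)
Lemma cfdot_Res_supplement :
  {in irr_constt Psi &, forall b c, '['Res[P] 'chi_b, 'Res[P] 'chi_c] = (b == c)%:R}.
Proof.
pose e b := '[Psi, 'chi_b]; pose d b g := '['Res[P] 'chi[M]_b, 'Res[P] 'chi[M]_g].
have Ne b: e b \in Num.nat by rewrite Cnat_cfdot_char ?cfInd_char ?irr_char.
have egt0 b: b \in irr_constt Psi -> e b > 0 by rewrite natr_gt0.
have DPsi : Psi = \sum_(b in irr_constt Psi) e b *: 'chi_b := cfun_sum_constt _.
have DPsiP : 'Res[P] Psi = \sum_(b in irr_constt Psi) e b *: 'Res[P] 'chi_b.
  by rewrite {1}DPsi linear_sum; apply: eq_bigr => b _; rewrite linearZ.
have charR b : 'Res[P] 'chi[M]_b \is a character by rewrite cfRes_char ?irr_char.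
pose d_delta := [forall b in irr_constt Psi, forall g in irr_constt Psi, d b g == (b == g)%:R].
have [_]: '[Psi] <= '['Res[P] Psi] ?= iff d_delta.
  pose sum_delta := \sum_(b in irr_constt Psi) e b *
     \sum_(g in irr_constt Psi) e g * (b == g)%:R.
  pose sum_d := \sum_(b in irr_constt Psi) e b * \sum_(g in irr_constt Psi) e g * d b g.
  have ->: '[Psi] = sum_delta.
    rewrite {1}DPsi cfdot_suml; apply: eq_bigr => b _.
    rewrite cfdotZl [X in '[_, X]]DPsi cfdot_sumr.
    by congr (_ * _); apply: eq_bigr => g; rewrite cfdotZr cfdot_irr conj_natr.
  have ->: '['Res[P] Psi] = sum_d.
    rewrite DPsiP cfdot_suml; apply: eq_bigr => b _.
    rewrite cfdotZl cfdot_sumr; congr (_ * _).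
    by apply: eq_bigr => g _; rewrite cfdotZr conj_natr.
  have eMmono := mono_leif (ler_pM2l (egt0 _ _)).
  apply: leif_sum => b /eMmono->; apply: leif_sum => g /eMmono->.
  split; last exact: eq_sym.
  have /natrP[n Dd]: d b g \in Num.nat by rewrite Cnat_cfdot_char.
  have [Db | _] := eqP; rewrite Dd leC_nat // -ltC_nat -Dd Db cfnorm_gt0.
  exact: Res_irr_neq0.
rewrite cfnorm_Ind_invariant cfnorm_Res_Ind_supplement eqxx.
by move=> /esym/forall_inP dd b c /dd/forall_inP ddb /ddb/eqP.
Qed.

Lemma Res_supplement_irr b : b \in irr_constt Psi -> 'Res[P] 'chi_b \in irr P.
Proof.
by move=> Sb; rewrite irrEchar cfRes_char ?irr_char //= cfdot_Res_supplement ?eqxx.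
Qed.

Lemma Res_supplement_inj :
  {in irr_constt Psi &, forall b c, 'Res[P] 'chi_b = 'Res[P] 'chi_c -> b = c}.
Proof.
move=> b c Sb Sc /(congr1 (cfdotr ('Res[P] 'chi_c))) /eqP.
by rewrite /= !cfdot_Res_supplement // eqxx pnatr_eq1; case: (b =P c).
Qed.

End ResSupplement.

(** * Special characters *)

(** A field automorphism applied to a matrix representation commutes with the
determinant. *)
Lemma cfDet_aut (gT : finGroupType) (G : {group gT}) (u : {rmorphism algC -> algC})
    (i : Iirr G) : cfDet (cfAut u 'chi_i) = cfAut u (cfDet 'chi_i).
Proof.
rewrite -irrRepr -cfRepr_map !cfDetRepr; apply/cfun_inP=> x Gx.
by rewrite !cfunE Gx !trace_mx11 !mxE !mulr1n map_reprE det_map_mx.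
Qed.

Lemma cforder_conjg (gT : finGroupType) (G : {group gT}) (phi : 'CF(G)) y :
  #[phi ^ y]%CF = #[phi]%CF.
Proof.
have E n : (#[phi ^ y]%CF %| n)%N = (#[phi]%CF %| n)%N.
  by rewrite !dvdn_cforder -rmorphXn /= cfConjg_eq1.
by apply/eqP; rewrite eqn_dvd E dvdnn -E dvdnn.
Qed.

Section Special.
Variables (gT : finGroupType) (pi : nat_pred) (G : {group gT}).

(** These are Gajendragadkar's pi-special characters, restricted to those
invariant in an ambient group G.  Instead of asking for the degree and the
determinantal order to be pi-numbers for all subnormal constituents, the two
consequences needed here are recorded: irreducibility on Hall pi-subgroups,
and the fact that the values at pi-elements determine the field of values. *)
Record pi_special (N : {group gT}) (a : Iirr N) : Prop := Special {
  special_inv : G \subset 'I['chi_a];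
  special_ord : pi.-nat 'o('chi_a)%CF;
  special_deg : pi.-nat (Num.truncn ('chi_a 1%g));
  special_Hall : forall P : {group gT}, pi.-Hall(N) P -> 'Res[P] 'chi_a \in irr P;
  special_aut : forall u : {rmorphism algC -> algC},
    {in N, forall x, pi.-elt x -> u ('chi_a x) = 'chi_a x} -> cfAut u 'chi_a = 'chi_a
}.

Lemma special1 : pi_special (N := 1%G) 0.
Proof.
have D0 : 'chi_(0 : Iirr [1 gT]%G) = 1 by rewrite irr0.
split; rewrite ?D0 ?rmorph1 //.
- by rewrite inertia1 norm1 subsetT.
- rewrite /cfDet_order cfDet_id ?cfun1_lin_char //.
  have /eqP->: #[1 : 'CF([1 gT])]%CF == 1%N by rewrite -dvdn1 dvdn_cforder expr1n.
- by [].
- by rewrite cfun1E group1 truncn1.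
- by move=> P _; rewrite rmorph1 cfun1_irr.
by move=> u _; rewrite rmorph1.
Qed.

Variables (M L : {group gT}).
Hypotheses (solM : solvable M) (nsLG : L <| G) (nsMG : M <| G) (sLM : L \subset M).

Let nsLM : L <| M := normalS sLM (normal_sub nsMG) nsLG.

Lemma Res_above_invariant (a : Iirr L) (c : Iirr M) :
    M \subset 'I['chi_a] -> c \in irr_constt ('Ind[M] 'chi_a) ->
  'Res[L] 'chi_c = '['Res[L] 'chi_c, 'chi_a] *: 'chi_a.
Proof.
rewrite constt_Ind_Res => IMa ca.
by rewrite {1}(Clifford_Res_sum_cfclass nsLM ca) cfclass_invariant // big_seq1.
Qed.

(** Across a pi'-factor the character has a unique extension of the same
determinantal order; by uniqueness this extension inherits every invariance of
b, and a Hall pi-subgroup of M already lies in L. *)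
Lemma special_extend (b : Iirr L) :
    pi_special b -> pi^'.-nat #|M : L| ->
  exists2 c : Iirr M, 'Res[L] 'chi_c = 'chi_b & pi_special c.
Proof.
case=> IGb pi_ob pi_db Hallb autb pi'ML.
have sMG := normal_sub nsMG.
have co_ML n : pi.-nat n -> coprime #|M : L| n.
  by move=> pi_n; rewrite coprime_sym (pnat_coprime pi_n).
have [|||c [cLb oc Uc]] := extend_solvable_coprime_irr (t := b) nsLM.
- exact: quotient_sol.
- exact: subset_trans IGb.
- by rewrite co_ML // pnatM pi_ob.
have co_c d : 'o('chi[M]_d)%CF = 'o('chi_c)%CF -> coprime #|M : L| 'o('chi_d)%CF.
  by move->; rewrite oc co_ML.
exists c => //; split.
- apply/subsetP=> g Gg; have nMg := subsetP (normal_norm nsMG) g Gg.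
  rewrite inE nMg; apply/eqP; rewrite -conjg_IirrE; congr ('chi_ _).
  apply: Uc; last first.
    apply: co_c; rewrite conjg_IirrE /cfDet_order cfDetConjg.
    exact: cforder_conjg.
  by rewrite conjg_IirrE -(cfConjgRes _ nsMG nsLG Gg) cLb (inertiaJ (subsetP IGb g Gg)).
- by rewrite oc.
- by rewrite -(cfRes1 L) cLb.
- move=> P hallP; have sPL : P \subset L.
    have nLP := subset_trans (pHall_sub hallP) (normal_norm nsLM).
    rewrite -quotient_sub1 // subG1 trivg_card1; apply/eqP.
    apply: (@pnat_1 pi); first exact: quotient_pgroup (pHall_pgroup hallP).
    apply: pgroupS (quotientS _ (pHall_sub hallP)) _.
    by rewrite /pgroup card_quotient ?normal_norm.
  rewrite -(cfResRes _ sPL sLM) cLb; apply: Hallb.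
  exact: pHall_subl sPL sLM hallP.
move=> u fix_u; rewrite -aut_IirrE; congr ('chi_ _); apply: Uc.
  rewrite aut_IirrE -cfAutRes cLb autb // => x Lx pi_x.
  by rewrite -cLb cfResE // fix_u // (subsetP sLM).
by apply: co_c; rewrite aut_IirrE /cfDet_order cfDet_aut cforder_aut.
Qed.

(** Across a pi-factor, a Hall pi-subgroup P of M supplements L, so that
restriction to P is irreducible and injective on the characters above a.  Thus
c is determined by its values at pi-elements. *)
Lemma special_above (a : Iirr L) (c : Iirr M) :
    pi_special a -> pi.-nat #|M : L| -> G \subset 'I['chi_c] ->
    c \in irr_constt ('Ind[M] 'chi_a) ->
  pi_special c.
Proof.
case=> IGa pi_oa pi_da Halla auta piML IGc ca.
have sMG := normal_sub nsMG.
have IMa : M \subset 'I['chi_a] by apply: subset_trans IGa.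
have cLa := Res_above_invariant IMa ca.
have /natrP[e De] : '['Res[L] 'chi_c, 'chi_a] \in Num.nat.
  by rewrite Cnat_cfdot_char ?cfRes_char ?irr_char.
rewrite De scaler_nat in cLa.
have hallPM (P : {group gT}) : pi.-Hall(M) P -> (L * P)%g = M /\ pi.-Hall(L) (P :&: L).
  move=> hallP; split; last exact: Hall_setI_normal hallP.
  have [sPM _ pi'P] := and3P hallP.
  by apply: coprime_index_mulG => //; apply: pnat_coprime pi'P.
have irrRes (P : {group gT}) : pi.-Hall(M) P -> 'Res[P] 'chi_c \in irr P.
  move=> hallP; have [defM hallPL] := hallPM P hallP.
  by apply: (Res_supplement_irr nsLM (pHall_sub hallP) defM IMa) => //; apply: Halla.
have [P hallP] := Hall_exists pi solM.
have [defM hallPL] := hallPM P hallP.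
split=> //.
- pose n := #|M : L|.
  have Xn x : x \in M -> (x ^+ n)%g \in L.
    move=> Mx; have nLx := subsetP (normal_norm nsLM) x Mx.
    by apply: coset_idr; rewrite ?groupX // morphX // /n -card_quotient ?normal_norm // expg_cardG ?mem_quotient.
  have lin_c : cfDet 'chi_c \is a linear_char := cfDet_lin_char _.
  have resDet : 'Res[L] (cfDet 'chi_c) = cfDet 'chi_a ^+ e.
    by rewrite -cfDetRes ?irr_char // cLa cfDetMn ?irr_char.
  apply: (@pnat_dvd _ (n * 'o('chi_a)%CF)); last by rewrite pnatM piML.
  apply/dvdn_cforderP=> x Mx; rewrite exprM -lin_charX // -(cfResE _ sLM) ?Xn //.
  rewrite resDet exp_cfunE ?Xn // -exprM mulnC exprM.
  have /dvdn_cforderP-> := dvdnn 'o('chi_a)%CF; rewrite ?expr1n //.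
  exact: Xn.
- have := irrRes P hallP => /irrP[i Di].
  have := dvd_irr1_cardG i; rewrite -Di cfRes1.
  rewrite -{1}(truncnK (Cnat_irr1 c)) dvdC_nat => /pnat_dvd; apply.
  exact: pHall_pgroup hallP.
move=> u fix_u; rewrite -aut_IirrE; congr ('chi_ _).
have e0 : e%:R != 0 :> algC.
  by rewrite -De -irr_consttE -constt_Ind_Res.
have fixa : cfAut u 'chi_a = 'chi_a.
  apply: auta => x Lx pi_x; apply: (mulfI e0).
  have Dx : e%:R * 'chi_a x = 'chi_c x by rewrite -(cfResE _ sLM) // cLa -scaler_nat cfunE.
  by rewrite -{1}(rmorph_nat u) -rmorphM Dx fix_u // (subsetP sLM).
apply: (Res_supplement_inj nsLM (pHall_sub hallP) defM IMa) => //.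
- exact: Halla hallPL.
- by rewrite irr_consttE aut_IirrE -fixa -cfAutInd cfdot_aut_irr fmorph_eq0 -irr_consttE.
apply/cfun_inP=> x Px; have sPM := pHall_sub hallP.
rewrite !cfResE // aut_IirrE cfunE fix_u ?(subsetP sPM) //.
exact: mem_p_elt (pHall_pgroup hallP) Px.
Qed.

End Special.

Section Factor.
Variables (gT : finGroupType) (G : {group gT}).
Hypothesis solG : solvable G.

(** The factor b extends to M, hence by the theorem of Gallagher the characters
above a * b are the products of this extension with the characters above a;
the G-invariance of the product passes to the factor above a by injectivity. *)
Lemma special_factor_step (pi rho : nat_pred) (M L : {group gT})
    (a b s : Iirr L) (t : Iirr M) :
    rho =i (negn pi) -> L <| G -> M <| G -> L \subset M -> pi.-nat #|M : L| ->
    pi_special pi G a -> pi_special rho G b -> 'chi_s = 'chi_a * 'chi_b ->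
    t \in irr_constt ('Ind[M] 'chi_s) -> G \subset 'I['chi_t] ->
  exists c d : Iirr M,
    [/\ 'chi_t = 'chi_c * 'chi_d, pi_special pi G c & pi_special rho G d].
Proof.
move=> rho_pi nsLG nsMG sLM piML spa spb Ds st IGt.
have sMG := normal_sub nsMG; have solM := solvableS sMG solG.
have nsLM : L <| M := normalS sLM sMG nsLG.
have [|d dL spd] := special_extend solM nsLG nsMG sLM spb.
  by rewrite (eq_pnat _ (eq_negn rho_pi)) pnatNK.
have IMa : M \subset 'I['chi_a] by apply: subset_trans (special_inv spa).
have irrab : 'chi_a * 'chi_b \in irr L by rewrite -Ds mem_irr.
have [irrS injS DS _] := constt_Ind_mul_ext nsLM dL IMa irrab.
move: st; rewrite Ds DS => /imageP[c Sc Dt].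
have Dtc : 'chi_t = 'chi_c * 'chi_d by rewrite Dt cfIirrE ?irrS.
exists c, d; split=> //.
apply: (special_above solM nsLG nsMG sLM spa piML _ Sc).
apply/subsetP=> g Gg; have nMg := subsetP (normal_norm nsMG) g Gg.
rewrite inE nMg /= -conjg_IirrE; apply/eqP; congr ('chi_ _).
apply: injS => //.
  rewrite irr_consttE conjg_IirrE -(inertiaJ (subsetP (special_inv spa) g Gg)).
  by rewrite -(cfConjgInd _ nsMG nsLG Gg) cfConjg_iso -irr_consttE.
rewrite /mul_Iirr; congr (cfIirr _); rewrite conjg_IirrE -Dtc.
rewrite -{1}(inertiaJ (subsetP (special_inv spd) g Gg)) -rmorphM /= -Dtc.
exact: (inertiaJ (subsetP IGt g Gg)).
Qed.

Variables (i : Iirr G) (pi : nat_pred).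
Hypothesis invRes : forall (N : {group gT}) (t : Iirr N),
  N <| G -> t \in irr_constt ('Res[N] 'chi_i) -> G \subset 'I['chi_t].

(** Induction along a chief series: each chief factor is a pi-group or a
pi'-group, and the two roles of a and b are exchanged accordingly. *)
Lemma special_factor (N : {group gT}) (t : Iirr N) :
    N <| G -> t \in irr_constt ('Res[N] 'chi_i) ->
  exists a b : Iirr N,
    [/\ 'chi_t = 'chi_a * 'chi_b, pi_special pi G a & pi_special (negn pi) G b].
Proof.
have [n] := ubnP #|N|; elim: n => // n IHn in N t * => ltNn nsNG tN.
have [N1 | ntN] := eqVneq N 1%G.
  move: t tN {nsNG ltNn}; rewrite N1 => t _.
  exists 0, 0; split; try exact: special1.
  rewrite irr0 mulr1; suff -> : t = 0 by rewrite irr0.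
  have : (#|Iirr [1 gT]| <= 1)%N by rewrite card_Iirr_abelian ?abelian1 ?cards1.
  by move/card_le1_eqP; apply.
have [L maxL _] : {L : {group gT} | maxnormal L N G & 1%G \subset L}.
  apply: maxgroup_exists; rewrite norms1 andbT proper1G; exact: ntN.
have [sLN nsLG] : L \proper N /\ L <| G.
  case/maxgroupP: maxL => /andP[prLN nLG] _; split=> //.
  by rewrite /normal nLG (subset_trans (proper_sub prLN)) ?normal_sub.
have sLN' := proper_sub sLN.
have nsLN : L <| N := normalS sLN' (normal_sub nsNG) nsLG.
have minNL : minnormal (N / L) (G / L).
  by apply: maxnormal_minnormal maxL; rewrite ?normal_norm.
have [|_ _] := minnormal_solvable minNL (quotientS _ (normal_sub nsNG)).
  exact: quotient_sol solG.
case/is_abelemP=> q q_pr /abelem_pgroup qNL.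
rewrite /pgroup card_quotient ?normal_norm // in qNL.
have [s sLt] : exists s, s \in irr_constt ('Res[L] 'chi_t).
  exact/neq0_has_constt/Res_irr_neq0.
have sLi : s \in irr_constt ('Res[L] 'chi_i).
  rewrite -(cfResRes _ sLN' (normal_sub nsNG)).
  apply: constt_Res_trans sLt; rewrite ?cfRes_char ?irr_char //.
have [|a [b [Ds spa spb]]] := IHn L s _ nsLG sLi.
  by apply: leq_trans (proper_card sLN) _.
have st : t \in irr_constt ('Ind[N] 'chi_s) by rewrite constt_Ind_Res.
have IGt := invRes nsNG tN.
have [pi_q | pi'q] := boolP (q \in pi).
  apply: special_factor_step spa spb Ds st IGt => //.
  exact: pi_pnat qNL pi_q.
have [|||c [d [Dt spc spd]]] := @special_factor_step (negn pi) pi N L b a s t _ nsLG nsNG sLN' _ spb spa _ st IGt.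
- by move=> r; rewrite negnK.
- by apply: pi_pnat qNL _.
- by rewrite mulrC.
by exists d, c; rewrite mulrC.
Qed.
End Factor.

(** * Values of characters under power maps *)

Lemma char_cycle_sum (gT : finGroupType) (G : {group gT}) (chi : 'CF(G)) x :
    chi \is a character -> x \in G ->
  exists r : seq (Iirr <[x]>), forall k, chi (x ^+ k)%g = \sum_(j <- r) ('chi_j x) ^+ k.
Proof.
move=> Nchi Gx; have sxG : <[x]> \subset G by rewrite cycle_subG.
have [r Dr] := char_sum_irr (cfRes_char <[x]> Nchi).
exists r => k; rewrite -(cfResE _ sxG) ?mem_cycle // Dr sum_cfunE.
apply: eq_bigr => j _; rewrite lin_charX ?cycle_id //.
exact/irr_cyclic_lin/cycle_cyclic.
Qed.

Lemma aut_char_expg (gT : finGroupType) (G : {group gT}) (chi : 'CF(G)) x n k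
    (u : {rmorphism algC -> algC}) :
    chi \is a character -> x \in G -> (#[x] %| n)%N ->
    (forall z, z ^+ n = 1 -> u z = z ^+ k) ->
  u (chi x) = chi (x ^+ k)%g.
Proof.
move=> Nchi Gx /dvdnP[m ->] Du; have [r Dr] := char_cycle_sum Nchi Gx.
rewrite Dr -{1}(expg1 x) Dr rmorph_sum; apply: eq_bigr => j _.
rewrite expr1 Du // mulnC exprM lin_char_unity_root ?cycle_id ?expr1n //.
exact/irr_cyclic_lin/cycle_cyclic.
Qed.

(** The inner binomial coefficients of a prime are divisible by it. *)
Lemma Aint_Frobenius (q : nat) (a b : algC) :
  prime q -> a \in Aint -> b \in Aint ->
  ((a + b) ^+ q == a ^+ q + b ^+ q %[mod q])%A.
Proof.
move=> q_pr Aa Ab; rewrite exprDn; have q_gt0 := prime_gt0 q_pr.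
rewrite -(eqAmodDr _ (- (a ^+ q + b ^+ q))) subrr eqAmod0.
case: q q_gt0 q_pr => // q _ q_pr.
rewrite big_ord_recl big_ord_recr /= subn0 bin0 !expr0 mulr1 mulr1n.
rewrite subSS subnn binn expr0 mul1r mulr1n.
set S := \sum_(i < q) _; have -> : a ^+ q.+1 + (S + b ^+ q.+1) - (a ^+ q.+1 + b ^+ q.+1) = S.
  by ring.
apply: rpred_sum => i _.
have /dvdnP[m ->] : (q.+1 %| 'C(q.+1, bump 0 i))%N.
  by rewrite prime_dvd_bin // /bump /= add1n ltnS ltn_ord.
by rewrite mulrnA -mulr_natr -eqAmod0 eqAmodMl0 // rpredMn // rpredM ?rpredX.
Qed.

Lemma Aint_Frobenius_sum (q : nat) (I : Type) (r : seq I) (F : I -> algC) :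
    prime q -> (forall i, F i \in Aint) ->
  ((\sum_(i <- r) F i) ^+ q == \sum_(i <- r) F i ^+ q %[mod q])%A.
Proof.
move=> q_pr AF; elim: r => [|i r IHr].
  by rewrite !big_nil expr0n gtn_eqF ?prime_gt0 // eqAmod_refl.
rewrite !big_cons; apply: eqAmod_trans (Aint_Frobenius q_pr _ _) _ => //.
  exact: rpred_sum.
by rewrite eqAmodDl.
Qed.

Lemma Aint_eqAmodX (e : algC) (x y : algC) n : x \in Aint -> y \in Aint ->
  (x == y %[mod e])%A -> (x ^+ n == y ^+ n %[mod e])%A.
Proof.
move=> Ax Ay xy; elim: n => [|n IHn]; first by rewrite eqAmod_refl.
by rewrite !exprS; apply: eqAmodM => //; apply: rpredX.
Qed.

(** If x has order q ^ m, then the q ^ m-th power of chi x is congruent to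
chi 1 modulo q, and q does not divide chi 1. *)
Lemma char_pelt_neq0 (q : nat) (gT : finGroupType) (G : {group gT})
    (chi : 'CF(G)) x :
    prime q -> chi \is a character -> x \in G -> q.-elt x ->
    ~~ (q %| Num.truncn (chi 1%g))%N ->
  chi x != 0.
Proof.
move=> q_pr Nchi Gx /p_natP[m ox]; apply: contraNneq => chi0.
have [r Dr] := char_cycle_sum Nchi Gx.
have Achi j : 'chi[<[x]>]_j x \in Aint by rewrite Aint_irr.
have cong n : ((\sum_(j <- r) 'chi_j x) ^+ (q ^ n)
               == \sum_(j <- r) 'chi_j x ^+ (q ^ n) %[mod q])%A.
  elim: n => [|n IHn]; first by rewrite expn0 expr1 eqAmod_refl.
  rewrite expnSr exprM; apply: eqAmod_trans (Aint_eqAmodX q _ _ IHn) _.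
  - by rewrite rpredX // rpred_sum.
  - by rewrite rpred_sum // => j _; rewrite rpredX.
  apply: eqAmod_trans (Aint_Frobenius_sum _ q_pr _) _ => [j|]; first exact: rpredX.
  by under eq_bigr do rewrite -exprM; rewrite eqAmod_refl.
have := cong m; rewrite -Dr -ox expg_order.
have -> : \sum_(j <- r) 'chi_j x = chi x.
  by rewrite -[x in RHS]expg1 Dr; under [RHS]eq_bigr do rewrite expr1.
rewrite chi0 expr0n gtn_eqF ?order_gt0 //= eqAmod_sym.
by rewrite -{1}(truncnK (Cnat_char1 Nchi)) eqAmod0_nat.
Qed.

(** * Power-stable characters of a solvable group *)

Lemma eq_expg_modn (gT : finGroupType) (x : gT) n k l :
  (#[x] %| n)%N -> k = l %[mod n] -> (x ^+ k = x ^+ l)%g.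
Proof.
move=> xn kl; apply/eqP; rewrite eq_expg_mod_order.
by rewrite -(modn_dvdm k xn) -(modn_dvdm l xn) kl.
Qed.

Section QuasiPrimitive.
Variables (gT : finGroupType) (G : {group gT}) (i : Iirr G).
Hypothesis solG : solvable G.
Hypothesis invRes : forall (N : {group gT}) (t : Iirr N),
  N <| G -> t \in irr_constt ('Res[N] 'chi_i) -> G \subset 'I['chi_t].
Local Notation n := #|G|.
Local Notation chi := 'chi_i.

(** Write chi as the product of a q-special a and a q'-special b.  On
q'-elements u' is trivial, so it fixes b.  On q-elements u' agrees with u, so
both fix the values of b, which are nonzero there; as u fixes chi, it fixes
the values of a at q-elements, and these control a. *)
Lemma aut_part_fix (q : nat) (k k' : nat) (u u' : {rmorphism algC -> algC}) :
    prime q ->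
    (forall z, z ^+ n = 1 -> u z = z ^+ k) -> (forall z, z ^+ n = 1 -> u' z = z ^+ k') ->
    k' = k %[mod n`_q] -> k' = 1 %[mod n`_q^'] ->
  cfAut u chi = chi -> cfAut u' chi = chi.
Proof.
move=> q_pr Du Du' k'q k'q' fix_chi.
have chiG : i \in irr_constt ('Res[G] chi) by rewrite cfRes_id constt_irr inE.
have [a [b [Dchi spa spb]]] := special_factor solG q invRes (normal_refl G) chiG.
have Eu c x : x \in G -> u ('chi[G]_c x) = 'chi_c (x ^+ k)%g.
  by move=> Gx; apply: aut_char_expg (irr_char c) Gx (order_dvdG Gx) Du.
have Eu' c x : x \in G -> u' ('chi[G]_c x) = 'chi_c (x ^+ k')%g.
  by move=> Gx; apply: aut_char_expg (irr_char c) Gx (order_dvdG Gx) Du'.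
have fixb : cfAut u' 'chi_b = 'chi_b.
  apply: (special_aut spb) => x Gx q'x; rewrite Eu' //; congr ('chi_b _).
  rewrite -[RHS]expg1; apply: eq_expg_modn k'q'.
  by rewrite -(part_pnat_id q'x) partn_dvd ?cardG_gt0 ?order_dvdG.
rewrite Dchi rmorphM /= fixb; congr (_ * _).
apply: (special_aut spa) => x Gx qx.
have xk : (x ^+ k' = x ^+ k)%g.
  apply: eq_expg_modn k'q.
  by rewrite -(part_pnat_id qx) partn_dvd ?cardG_gt0 ?order_dvdG.
have ub : u ('chi_b x) = 'chi_b x.
  by rewrite Eu // -xk -Eu' // -[RHS](congr1 (fun f : 'CF(G) => f x) fixb) cfunE.
have b0 : 'chi_b x != 0.
  apply: (char_pelt_neq0 q_pr (irr_char b) Gx qx).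
  by rewrite -p'natE // (special_deg spb).
rewrite Eu' // xk -Eu //; apply: (mulIf b0).
rewrite -{1}ub -rmorphM.
have -> : 'chi_a x * 'chi_b x = chi x by rewrite Dchi cfunE.
by rewrite -[RHS](congr1 (fun f : 'CF(G) => f x) fix_chi) cfunE.
Qed.

Definition pow_stable k := [forall x in G, chi (x ^+ k)%g == chi x].

Lemma pow_stableP k : reflect {in G, forall x, chi (x ^+ k)%g = chi x} (pow_stable k).
Proof. exact: eqfun_inP. Qed.

Lemma pow_stable_mod k l : k = l %[mod n] -> pow_stable k = pow_stable l.
Proof.
move=> kl; apply: eq_forallb => x; case Gx: (x \in G) => //=.
by rewrite (eq_expg_modn (order_dvdG Gx) kl).
Qed.

Lemma pow_stableM k l : pow_stable k -> pow_stable l -> pow_stable (k * l).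
Proof.
move=> /pow_stableP sk /pow_stableP sl; apply/pow_stableP => x Gx.
by rewrite expgM sl ?groupX ?sk.
Qed.

Lemma pow_stable1 : pow_stable 1.
Proof. by apply/pow_stableP=> x _; rewrite expg1. Qed.

(** The power map and the automorphism have the same effect on the values of
a character. *)
Lemma pow_stable_aut k (u : {rmorphism algC -> algC}) :
  (forall z, z ^+ n = 1 -> u z = z ^+ k) -> pow_stable k = (cfAut u chi == chi).
Proof.
move=> Du; apply/pow_stableP/eqP=> [sk | fix_chi].
  apply/cfun_inP=> x Gx; rewrite cfunE.
  by rewrite (aut_char_expg (irr_char i) Gx (order_dvdG Gx) Du) sk.
move=> x Gx; rewrite -(aut_char_expg (irr_char i) Gx (order_dvdG Gx) Du).
by rewrite -[RHS](congr1 (fun f : 'CF(G) => f x) fix_chi) cfunE.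
Qed.

(** The q-part of the conductor of chi divides q ^ a. *)
Definition loc_cond (q a : nat) :=
  [forall k : 'I_n, coprime k n && (k == 1 %[mod n`_q^' * q ^ a])%N ==> pow_stable k].

Lemma loc_condP (q a : nat) : (n`_q^' * q ^ a %| n)%N -> reflect
  (forall k, coprime k n -> k = 1 %[mod n`_q^' * q ^ a] -> pow_stable k) (loc_cond q a).
Proof.
move=> dv; apply: (iffP forallP) => [H k co_k k1 | H k]; last first.
  by apply/implyP=> /andP[co_k /eqP k1]; apply: H.
have ltk : (k %% n < n)%N by rewrite ltn_mod cardG_gt0.
have /implyP := H (Ordinal ltk); rewrite /= coprime_modl co_k modn_dvdm // k1 eqxx.
by move/(_ isT); rewrite (pow_stable_mod (l := k)) // modn_mod.
Qed.

Lemma partn_pow_dvd (q a : nat) : prime q -> (a <= logn q n)%N -> (n`_q^' * q ^ a %| n)%N.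
Proof.
move=> q_pr le_a; rewrite -[X in (_ %| X)%N](partnC q (cardG_gt0 G)) mulnC.
by rewrite dvdn_mul // p_part dvdn_exp2l.
Qed.

Lemma loc_cond_exp (q : nat) : prime q -> loc_cond q (logn q n).
Proof.
move=> q_pr; apply/(loc_condP (partn_pow_dvd q_pr (leqnn _))) => k _.
rewrite -p_part mulnC partnC ?cardG_gt0 // => k1.
by rewrite (pow_stable_mod k1) pow_stable1.
Qed.

End QuasiPrimitive.

Lemma eqn_mod_partP (n x y : nat) : (0 < n)%N ->
  (forall q : nat, prime q -> x = y %[mod n`_q]) -> x = y %[mod n].
Proof.
move=> n_gt0; wlog le_yx : x y / (y <= x)%N.
  by case/orP: (leq_total y x) => le IH H; [|symmetry]; apply: IH => // q /H.
move=> H; apply/eqP; rewrite eqn_mod_dvd //; apply/dvdn_partP=> // q.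
rewrite mem_primes => /andP[q_pr _]; rewrite -eqn_mod_dvd //.
exact/eqP/H.
Qed.

Lemma prod_mod1 (I : finType) (P : pred I) (F : I -> nat) m :
  (forall j, P j -> F j = 1 %[mod m]) -> (\prod_(j | P j) F j)%N = 1 %[mod m].
Proof.
move=> H; elim/big_ind: _ => // x y x1 y1.
by rewrite -modnMm x1 y1 modnMm.
Qed.

Lemma partn_dvd_p'part (n q r : nat) : prime q -> r != q -> (n`_q %| n`_r^')%N.
Proof.
move=> q_pr rq; apply: sub_in_partn => s _; rewrite !inE => /eqP->.
by rewrite eq_sym.
Qed.

Section QuasiPrimitive.
Variables (gT : finGroupType) (G : {group gT}) (i : Iirr G).
Hypothesis solG : solvable G.
Hypothesis invRes : forall (N : {group gT}) (t : Iirr N),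
  N <| G -> t \in irr_constt ('Res[N] 'chi_i) -> G \subset 'I['chi_t].
Local Notation n := #|G|.
Local Notation chi := 'chi_i.
Local Notation stable := (pow_stable i).

(** Here q ^ (a q) is the q-part of the conductor of chi, k q is an exponent
which shows that a q cannot be lowered, and A is the alternating sum of the
transforms of chi. *)
Lemma Feit_quasi_primitive :
  exists2 g, g \in G & forall k, coprime k n -> k = 1 %[mod #[g]] -> stable k.
Proof.
have n_gt0 := cardG_gt0 G.
pose I := 'I_n.+1.
have /fin_all_exists[a Ha] (q : I) : exists aq : nat, prime q ->
    [/\ (aq <= logn q n)%N, loc_cond i q aq & (0 < aq)%N -> ~~ loc_cond i q aq.-1].
  case: (boolP (prime q)) => [q_pr|]; last by exists 0%N.
  have ex : exists aq, loc_cond i q aq by exists (logn q n); apply: loc_cond_exp.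
  case: (ex_minnP ex) => m lm mmin; exists m => _; split=> //.
    exact/mmin/loc_cond_exp.
  by move=> m_gt0; apply/negP => /mmin; rewrite -ltnS prednK // ltnn.
pose Q := [set q : I | prime q && (0 < a q)%N].
have /fin_all_exists[k Hk] (q : I) : exists k : nat,
    [/\ coprime k n, (q \in Q -> k = 1 %[mod n`_q^' * q ^ (a q).-1]) & (q \in Q -> ~~ stable k)].
  case: (boolP (q \in Q)) => [|_]; last by exists 1%N; rewrite coprime1n.
  rewrite inE => /andP[q_pr aq_gt0]; have [_ _ /(_ aq_gt0)] := Ha q q_pr.
  rewrite negb_forall => /existsP[k]; rewrite negb_imply => /andP[/andP[co_k /eqP k1] st].
  by exists k.
pose kS (S : {set I}) := (\prod_(q in S) k q)%N.
have co_kS S : coprime (kS S) n.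
  rewrite /kS; elim/big_ind: _ => [|y z cy cz|q _]; first exact: coprime1n.
    by rewrite coprimeMl cy.
  by case: (Hk q).
have /fin_all_exists[U HU] (S : {set I}) :
    exists u : {rmorphism algC -> algC}, forall z, z ^+ n = 1 -> u z = z ^+ (kS S).
  by have [u] := Qn_aut_exists (co_kS S); exists u.
(* For S nonempty the transform differs from chi: otherwise [aut_part_fix],
   applied to any q in S, would make chi stable under k q. *)
pose A := \sum_(S : {set I} | S \subset Q) (-1) ^+ #|S| *: cfAut (U S) chi.
have A_chi : '[A, chi] = 1.
  rewrite cfdot_suml (bigD1 set0) ?sub0set //= cards0 expr0 scale1r.
  have /eqP-> : cfAut (U set0) chi == chi.
    by rewrite -(pow_stable_aut i (HU set0)) /kS big_set0 pow_stable1.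
  rewrite cfnorm_irr big1 ?addr0 // => S /andP[sSQ /set0Pn[q Sq]].
  rewrite cfdotZl -aut_IirrE cfdot_irr; case: eqP => [Ei|]; last by rewrite mulr0.
  have Qq := subsetP sSQ q Sq; have [co_k k1 /(_ Qq)/negP[]] := Hk q.
  have q_pr : prime q by move: Qq; rewrite inE => /andP[].
  have [u' Du'] := Qn_aut_exists co_k.
  rewrite (pow_stable_aut i Du'); apply/eqP.
  apply: (aut_part_fix solG invRes q_pr (HU S) Du'); last by rewrite -aut_IirrE Ei.
  - rewrite /kS (bigD1 q) //= -[in LHS](muln1 (k q)) -modnMmr -[RHS]modnMmr.
    congr ((_ * _) %% _)%N; symmetry; apply: prod_mod1 => r /andP[Sr rq].
    have [_ /(_ (subsetP sSQ r Sr)) kr1 _] := Hk r.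
    have d : (n`_q %| n`_r^' * r ^ (a r).-1)%N by rewrite dvdn_mulr // partn_dvd_p'part.
    by rewrite -(modn_dvdm _ d) kr1 (modn_dvdm _ d).
  by have d := dvdn_mulr (q ^ (a q).-1) (dvdnn n`_q^'); rewrite -(modn_dvdm _ d) k1 ?(modn_dvdm _ d).
have [x Gx Ax] : exists2 x, x \in G & A x != 0.
  apply/exists_inP; apply: contraT; rewrite negb_exists_in => /forall_inP A0.
  have Z : A = 0 by apply/cfun_inP=> x /A0; rewrite negbK cfunE => /eqP.
  by move/eqP: A_chi; rewrite Z cfdot0l eq_sym oner_eq0.
have DAx : A x = \sum_(S : {set I} | S \subset Q) (-1) ^+ #|S| * chi (x ^+ kS S)%g.
  rewrite sum_cfunE; apply: eq_bigr => S _; rewrite !cfunE.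
  by rewrite (aut_char_expg (irr_char i) Gx (order_dvdG Gx) (HU S)).
have ordx q : q \in Q -> (q ^ a q %| #[x])%N.
  move=> Qq; have q_pr : prime q by move: Qq; rewrite inE => /andP[].
  have aq_gt0 : (0 < a q)%N by move: Qq; rewrite inE => /andP[].
  apply: contraR Ax => Ndv; have [_ /(_ Qq) k1 _] := Hk q.
  have xk : (x ^+ k q = x)%g.
    rewrite -[RHS]expg1. apply: eq_expg_modn k1.
    rewrite -(partnC q (order_gt0 x)) mulnC dvdn_mul //.
      by rewrite partn_dvd ?order_dvdG.
    rewrite p_part dvdn_exp2l // -ltnS prednK //.
    by rewrite ltnNge -pfactor_dvdn.
  (* Toggling q in S changes the sign but not the value of a term. *)
  pose tau (S : {set I}) := if q \in S then S :\ q else q |: S.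
  have tauK : involutive tau.
    move=> S; rewrite /tau; case: (boolP (q \in S)) => Sq.
      by rewrite setD11 setD1K.
    by rewrite setU11 setU1K.
  have f_add (S : {set I}) : q \notin S -> (x ^+ kS (q |: S) = x ^+ kS S)%g.
    by move=> S'q; rewrite /kS big_setU1 //= expgM xk.
  suff : A x = - A x by move/eqP; rewrite -subr_eq0 opprK -mulr2n mulrn_eq0.
  rewrite DAx -sumrN (reindex_inj (inv_inj tauK)) /=; apply: eq_big => S.
    rewrite /tau; case: ifP => Sq; last by rewrite subUset sub1set Qq.
    apply/idP/idP => [sSQ | ]; last exact: subset_trans (subsetDl _ _).
    by rewrite -(setD1K Sq) subUset sub1set Qq.
  move=> _; rewrite -mulNr /tau; case: (boolP (q \in S)) => Sq.
    rewrite -{3 4}(setD1K Sq) f_add ?setD11 // [#|q |: _|]cardsU1 setD11 add1n exprS.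
    by rewrite mulN1r opprK.
  by rewrite f_add // cardsU1 Sq add1n exprS mulN1r.
exists x => // l co_l l1.
(* Modulo n, the exponent l is the product of the c q, each of which is 1
   modulo the q'-part of n. *)
pose c q := chinese n`_q n`_q^' l 1.
have co_qq' q : coprime n`_q n`_q^' by exact: coprime_partC.
have cq q : c q = l %[mod n`_q] by exact: chinese_modl.
have cq' q : c q = 1 %[mod n`_q^'] by exact: chinese_modr.
have dvI q : prime q -> stable (c q).
  move=> q_pr; case: (boolP (q %| n)%N) => [dqn | Ndqn]; last first.
    rewrite (pow_stable_mod i (l := 1)) ?pow_stable1 //.
    have := cq' q; rewrite part_pnat_id ?n_gt0 // p'natE //.
  have lt_q : (q < n.+1)%N by rewrite ltnS dvdn_leq.
  have [le_a /(loc_condP i (partn_pow_dvd q_pr _)) lc _] := Ha (Ordinal lt_q) q_pr.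
  apply: (lc le_a).
    rewrite -(partnC q n_gt0) coprimeMr -coprime_modl cq coprime_modl.
    rewrite (coprime_dvdr (dvdn_part _ _) co_l) /=.
    by rewrite -coprime_modl cq' coprime_modl coprime1n.
  apply/eqP; rewrite chinese_remainder; last first.
    by rewrite coprime_sym (coprime_dvdl _ (co_qq' q)) // p_part dvdn_exp2l.
  rewrite cq' eqxx /=; apply/eqP.
  have d1 : (q ^ a (Ordinal lt_q) %| n`_q)%N by rewrite p_part dvdn_exp2l.
  have d2 : (q ^ a (Ordinal lt_q) %| #[x])%N.
    have [-> | a_gt0] := posnP (a (Ordinal lt_q)); first by rewrite expn0 dvd1n.
    by apply: (ordx (Ordinal lt_q)); rewrite inE /= q_pr.
  by rewrite -(modn_dvdm _ d1) cq (modn_dvdm _ d1) -(modn_dvdm _ d2) l1 (modn_dvdm _ d2).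
rewrite (pow_stable_mod i (l := (\prod_(q : I | prime q) c q)%N)).
  by elim/big_ind: _ => [|y z|q /dvI] //; [apply: pow_stable1 | apply: pow_stableM].
apply: eqn_mod_partP => // q q_pr.
case: (boolP (q %| n)%N) => [dqn | Ndqn]; last first.
  by rewrite part_p'nat ?modn1 // p'natE.
have lt_q : (q < n.+1)%N by rewrite ltnS dvdn_leq.
rewrite (bigD1 (Ordinal lt_q)) //= -modnMm cq prod_mod1 => [|r /andP[r_pr rq]].
  by rewrite modnMm muln1.
have d : (n`_q %| n`_r^')%N by rewrite partn_dvd_p'part.
by rewrite -(modn_dvdm _ d) cq' (modn_dvdm _ d).
Qed.

End QuasiPrimitive.

(** Either every restriction to a normal subgroup is homogeneous, or chi is
induced from the proper inertia subgroup of a constituent t. *)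
Theorem Feit_irr (gT : finGroupType) (G : {group gT}) (i : Iirr G) :
    solvable G ->
  exists2 g, g \in G &
    forall k, coprime k #|G| -> k = 1 %[mod #[g]] -> pow_stable i k.
Proof.
have [m] := ubnP #|G|; elim: m => // m IHm in G i * => ltGm solG.
have [/forall_inP inv | ] := boolP [forall (N : {group gT} | N <| G),
    [forall t in irr_constt ('Res[N] 'chi_i), G \subset 'I['chi_t]]].
  by apply: Feit_quasi_primitive => // N t /inv/forall_inP/(_ t).
rewrite negb_forall_in => /exists_inP[N nsNG].
rewrite negb_forall_in => /exists_inP[t iNt notinv].
have [irrA _ DB _ _] := constt_Inertia_bijection t nsNG.
have : i \in Ind_Iirr G @: irr_constt ('Ind['I_G['chi_t]] 'chi_t).
  by rewrite DB constt_Ind_Res.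
case/imsetP=> s As Di.
have Dchi : 'chi_i = 'Ind[G] 'chi_s by rewrite Di cfIirrE ?irrA.
pose T := 'I_G['chi_t]%G.
have prTG : T \proper G by rewrite properE subsetIl /= subsetI subxx.
have [|g Tg stg] := IHm T s _ (solvableS (proper_sub prTG) solG).
  exact: leq_trans (proper_card prTG) _.
exists g => [|k co_k k1]; first exact: subsetP (proper_sub prTG) g Tg.
have dTG : (#|T| %| #|G|)%N by rewrite cardSg ?proper_sub.
have [u Du] := Qn_aut_exists co_k.
rewrite (pow_stable_aut i Du) Dchi cfAutInd.
have : pow_stable s k by apply: stg k1; apply: coprime_dvdr co_k.
rewrite (@pow_stable_aut _ _ s k u) => [/eqP -> //|z z1].
by apply: Du; case/dvdnP: dTG => e ->; rewrite mulnC exprM z1 expr1n.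
Qed.

(** * Homogeneous modules over an algebraically closed field *)

Section Homogeneous.

Variables (F : closedFieldType) (gT : finGroupType) (N : {group gT}) (n : nat).
Variables (rN : mx_representation F N n) (U : 'M[F]_n).
Hypotheses (simU : mxsimple rN U) (homU : (1%:M <= component_mx rN U)%MS).

Local Notation E := (enveloping_algebra_mx rN).

Lemma envelop_mxD A B : (A \in E -> B \in E -> A + B \in E)%MS.
Proof. by move=> EA EB; rewrite linearD addmx_sub. Qed.

Lemma envelop_mxZ a A : (A \in E -> a *: A \in E)%MS.
Proof. by move=> EA; rewrite linearZ scalemx_sub. Qed.

Lemma envelop_scalar a : (a%:M \in E)%MS.
Proof. by rewrite -[a%:M]scalemx1 envelop_mxZ ?envelop_mx1. Qed.

Lemma envelop_mxB A B : (A \in E -> B \in E -> A - B \in E)%MS.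
Proof. by move=> EA EB; rewrite -scaleN1r envelop_mxD ?envelop_mxZ. Qed.

(** The module is a sum of copies of U, and the elements of the enveloping
algebra commute with the isomorphisms between these copies. *)
Lemma homogeneous_inj A : (A \in E)%MS -> U *m A = 0 -> A = 0.
Proof.
move=> EA UA0; apply/eqP; rewrite -[A]mul1mx; apply/eqP/sub_kermxP.
apply: submx_trans homU _; have [I [W isoUW ->]] := component_mx_def simU.
apply/sumsmx_subP=> j _; have [f _ homUf defW] := isoUW j.
rewrite -defW; apply/sub_kermxP.
by rewrite -(hom_envelop_mxC homUf EA) UA0 mul0mx.
Qed.

Lemma homogeneous_inj2 A B : (A \in E)%MS -> (B \in E)%MS -> U *m A = U *m B -> A = B.
Proof.
move=> EA EB UAB; apply/eqP; rewrite -subr_eq0; apply/eqP.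
by apply: homogeneous_inj; rewrite ?envelop_mxB // mulmxBr UAB subrr.
Qed.

Let modU := mxsimple_module simU.
Let absU : mx_absolutely_irreducible (submod_repr modU).
Proof. exact/group_closure_closed_field/submod_mx_irr. Qed.

Let V1 : 'M_(\rank U, n) := val_submod 1%:M.
Let sV1 : (V1 <= U)%MS. Proof. exact: val_submodP. Qed.
Let UV1 : exists C, U = C *m V1.
Proof. by apply/submxP; rewrite val_submod1. Qed.
Let UV1E : exists C, forall A : 'M_n, U *m A = C *m (V1 *m A).
Proof. by have [C DC] := UV1; exists C => A; rewrite mulmxA -DC. Qed.

(** This is Burnside's theorem for U, which is absolutely irreducible. *)
Lemma homogeneous_dense B : (U *m B <= U)%MS ->
  exists2 T, (T \in E)%MS & U *m T = U *m B.
Proof.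
move=> sUB; case/mx_abs_irrP: absU => _ [a_ Da].
pose B' : 'M_(\rank U) := in_submod U (V1 *m B).
exists (\sum_(x in N) a_ x B' *: rN x); first by apply/envelop_mxP; exists (a_^~ B').
have VT : V1 *m (\sum_(x in N) a_ x B' *: rN x) = V1 *m B.
  transitivity (val_submod (B')).
    rewrite [in RHS](Da B') [RHS]linear_sum mulmx_sumr; apply: eq_bigr => x Nx.
    by rewrite -scalemxAr linearZ -[submod_repr modU x]mul1mx /= val_submodJ.
  by rewrite in_submodK // (submx_trans (submxMr _ sV1)).
by have [C DC] := UV1E; rewrite !DC VT.
Qed.

(** By Schur's lemma the restriction of A to U is scalar, and elements of the
enveloping algebra are determined by their restriction to U. *)
Lemma homogeneous_center A :
  (A \in E)%MS -> centgmx rN A -> is_scalar_mx A.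
Proof.
move=> EA cA; pose A' : 'M_(\rank U) := in_submod U (V1 *m A).
have VA (W : 'M_(\rank U)) : val_submod (W *m A') = val_submod W *m A.
  rewrite val_submodE -mulmxA -[A' *m _]val_submodE in_submodK; last first.
    exact: (mxmodule_envelop modU EA sV1).
  by rewrite mulmxA -val_submodE.
have /is_scalar_mxP[a DA'] : is_scalar_mx A'.
  apply: (mx_abs_irr_cent_scalar absU); apply/centgmxP=> x Nx.
  apply: val_submod_inj; rewrite val_submodJ // -[A']mul1mx VA.
  rewrite -mulmxA (centgmxP cA) // mulmxA mul1mx VA; congr (_ *m _).
  by rewrite -[submod_repr modU x]mul1mx /= val_submodJ.
apply/is_scalar_mxP; exists a.
apply: homogeneous_inj2; rewrite ?envelop_scalar //.
have [C DC] := UV1E; rewrite !DC; congr (_ *m _); rewrite -VA mul1mx DA'.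
by rewrite mul_mx_scalar -scalemx1 linearZ.
Qed.

End Homogeneous.

Section PQuotient.

Variables (F : closedFieldType) (gT : finGroupType) (M L : {group gT}) (n : nat).
Variables (rM : mx_representation F M n) (nsLM : L <| M).
Let sLM := normal_sub nsLM.
Let rL := subg_repr rM sLM.
Local Notation EL := (enveloping_algebra_mx rL).
Local Notation EM := (enveloping_algebra_mx rM).

Lemma envelop_subg A : (A \in EL -> A \in EM)%MS.
Proof.
move/envelop_mxP=> [a ->]; rewrite linear_sum summx_sub //= => x Lx.
by rewrite linearZ scalemx_sub //= envelop_mx_id // (subsetP sLM).
Qed.

Lemma envelop_sub_id l : l \in L -> (rM l \in EL)%MS.
Proof. exact: (envelop_mx_id rL). Qed.

Variable U : 'M[F]_n.
Hypotheses (simU : mxsimple rL U) (homU : (1%:M <= component_mx rL U)%MS).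

(** As the module is homogeneous for L, the conjugate of U by m is isomorphic
to U, so that conjugation by m is realised on U by an element T' of the
enveloping algebra of L; T is its inverse. *)
Lemma homogeneous_twist m : m \in M ->
  exists T T' : 'M[F]_n, [/\ (T \in EL)%MS, (T' \in EL)%MS, T *m T' = 1%:M
    & {in L, forall l, rM l *m (T *m rM m) = T *m rM m *m rM l}].
Proof.
move=> Mm; have Mm' : (m^-1)%g \in M by rewrite groupV.
have modU := mxsimple_module simU.
have [f injf homUf defV] : mx_iso rL U (U *m rM m).
  apply: component_mx_iso => //; first exact: Clifford_simple.
  exact: submx_trans (submx1 _) homU.
pose B := f *m rM (m^-1)%g; pose B' := rM m *m invmx f.
have UB : (U *m B :=: U)%MS.
  by rewrite /B mulmxA; apply: eqmx_trans (eqmxMr _ defV) _; rewrite repr_mxK.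
have UB' : (U *m B' :=: U)%MS.
  by rewrite /B' mulmxA; apply: eqmx_trans (eqmxMr _ (eqmx_sym defV)) _; rewrite mulmxK.
have BB' : B *m B' = 1%:M.
  by rewrite /B /B' mulmxA -(mulmxA f) -repr_mxM // mulVg repr_mx1 mulmx1 mulmxV.
have [|T ET DT] := homogeneous_dense simU (B := B); first by rewrite UB.
have [|T' ET' DT'] := homogeneous_dense simU (B := B'); first by rewrite UB'.
have act W A C : (W <= U)%MS -> U *m A = U *m C -> W *m A = W *m C :> 'M_n.
  by case/submxP=> D -> UAC; rewrite -!mulmxA UAC.
have TT' : T *m T' = 1%:M.
  apply: (homogeneous_inj2 simU homU); rewrite ?envelop_mxM ?envelop_mx1 //.
  by rewrite mulmxA DT (act _ T' B') ?UB // -mulmxA BB'.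
exists T, T'; split=> // l Ll; have Ml := subsetP sLM l Ll.
have Llm : (l ^ m^-1)%g \in L by rewrite memJ_norm // (subsetP (normal_norm nsLM)).
have -> : rM l *m (T *m rM m) = T *m rM (l ^ m^-1)%g *m rM m; last first.
  by rewrite -!mulmxA -!repr_mxM ?(subsetP sLM _ Llm) // conjgE invgK !mulgA mulgKV.
rewrite mulmxA; congr (_ *m _).
apply: (homogeneous_inj2 simU homU); rewrite ?envelop_mxM ?envelop_sub_id //.
rewrite !mulmxA DT (act _ T B) //; last exact: (mxmoduleP modU).
rewrite /B !mulmxA (hom_mxP homUf l Ll) /= -!mulmxA -!(repr_mxM rM) ?(subsetP sLM _ Llm) //.
by rewrite conjgE invgK !mulgA mulVg mul1g.
Qed.

Variables (p : nat) (W : 'M[F]_n).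
Hypotheses (charFp : p \in [pchar F]) (abML : abelian (M / L)) (pML : p.-group (M / L)).
Hypotheses (simW : mxsimple rM W) (homW : (1%:M <= component_mx rM W)%MS).

(** Write rM m = T' *m c with T' in the enveloping algebra of L and c
centralising L.  For another element y of M with factor d, the commutator of
c and d centralises L and lies in the enveloping algebra of L, hence is a
scalar b.  Then b is a root of unity of p-power order, so b = 1 in
characteristic p, and c centralises M.  Since the module is homogeneous for M
as well, c is a scalar. *)
Lemma p_quotient_envelop m : m \in M -> (rM m \in EL)%MS.
Proof.
move=> Mm; have [T [T' [ET ET' TT' cT]]] := homogeneous_twist Mm.
have T'T : T' *m T = 1%:M := mulmx1C TT'.
pose c := T *m rM m.
have rMm : rM m = T' *m c by rewrite mulmxA T'T mul1mx.
pose c' := rM (m^-1)%g *m T'.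
have cc' : c *m c' = 1%:M by rewrite /c /c' mulmxA repr_mxK.
have c'c : c' *m c = 1%:M := mulmx1C cc'.
have EMc : (c \in EM)%MS by rewrite envelop_mxM ?envelop_mx_id ?envelop_subg.
have {}cT : {in L, forall l, rM l *m c = c *m rM l} := cT.
clearbody c c'.
have cE (d : 'M[F]_n) A : {in L, forall l, rM l *m d = d *m rM l} -> (A \in EL)%MS ->
   A *m d = d *m A.
  move=> cd /envelop_mxP[a ->]; rewrite mulmx_suml mulmx_sumr.
  by apply: eq_bigr => l Ll; rewrite -scalemxAl -scalemxAr cd.
have ccomm : centgmx rM c.
  apply/centgmxP=> y My; have [S [S' [ES ES' SS' cS]]] := homogeneous_twist My.
  have S'S : S' *m S = 1%:M := mulmx1C SS'.
  pose d := S *m rM y; pose d' := rM (y^-1)%g *m S'.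
  have rMy : rM y = S' *m d by rewrite mulmxA S'S mul1mx.
  have dd' : d *m d' = 1%:M by rewrite /d /d' mulmxA repr_mxK.
  have d'd : d' *m d = 1%:M := mulmx1C dd'.
  have {}cS : {in L, forall l, rM l *m d = d *m rM l} := cS.
  clearbody d d'.
  pose z := [~ m^-1, y^-1]%g.
  have Lz : z \in L.
    have /subsetP nLM := normal_norm nsLM.
    apply: coset_idr; first by rewrite groupR ?nLM ?groupV.
    rewrite morphR ?nLM ?groupV //; apply/eqP/commgP.
    by apply: (centsP abML); rewrite mem_quotient ?groupV.
  have mz : (m * y = z * (y * m))%g.
    by rewrite /z commgEl conjgE !invgK !mulgA !mulgKV.
  have Lz' : z \in M := subsetP sLM z Lz.
  clearbody z.
  have cd' A : (A \in EL)%MS -> A *m d = d *m A := cE d A cS.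
  have cc A : (A \in EL)%MS -> A *m c = c *m A := cE c A cT.
  have KE : c *m d = S *m T *m rM z *m S' *m T' *m (d *m c).
    have E1 : T' *m S' *m (c *m d) = rM m *m rM y.
      by rewrite rMm rMy -!mulmxA (mulmxA S' c) cc // !mulmxA.
    have E2 : S' *m T' *m (d *m c) = rM y *m rM m.
      by rewrite rMm rMy -!mulmxA (mulmxA T' d) cd' // !mulmxA.
    rewrite -(mulmxA _ T') -(mulmxA _ S') (mulmxA S') E2.
    rewrite -mulmxA -!repr_mxM ?groupM //. rewrite -mz repr_mxM // -E1.
    by rewrite !mulmxA -(mulmxA S T) TT' mulmx1 SS' mul1mx.
  (* The left factor is the commutator of c and d. *)
  have /is_scalar_mxP[b Db] : is_scalar_mx (S *m T *m rM z *m S' *m T').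
    apply: (homogeneous_center simU homU).
      by rewrite !envelop_mxM ?envelop_sub_id.
    have -> : S *m T *m rM z *m S' *m T' = c *m d *m (c' *m d').
      rewrite KE -!mulmxA; do 4!congr (_ *m _).
      rewrite (mulmxA c) cc' mul1mx dd' mulmx1 //.
    apply/centgmxP=> l Ll /=.
    have comM (X Y : 'M[F]_n) : X *m rM l = rM l *m X -> Y *m rM l = rM l *m Y ->
        (X *m Y) *m rM l = rM l *m (X *m Y).
      by move=> XC YC; rewrite -mulmxA YC mulmxA XC mulmxA.
    have comV (X X' : 'M[F]_n) : X *m X' = 1%:M -> X' *m X = 1%:M ->
        X *m rM l = rM l *m X -> X' *m rM l = rM l *m X'.
      move=> XX' X'X XC; rewrite -[LHS]mulmx1 -XX' mulmxA -(mulmxA X' _ X) -XC.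
      by rewrite mulmxA X'X mul1mx.
    have lc := esym (cT l Ll); have ld := esym (cS l Ll).
    by rewrite !comM // ?(comV c c') ?(comV d d').
  rewrite Db in KE.
  have cy : c *m rM y = b *: (rM y *m c).
    rewrite rMy mulmxA -cc // -mulmxA KE mul_scalar_mx -scalemxAr.
    by rewrite !mulmxA.
  have cyk k : c *m rM (y ^+ k)%g = b ^+ k *: (rM (y ^+ k)%g *m c).
    elim: k => [|k IHk]; first by rewrite expg0 repr_mx1 mulmx1 mul1mx scale1r.
    rewrite expgSr repr_mxM ?groupX // mulmxA IHk -scalemxAl -(mulmxA _ c) cy.
    by rewrite -scalemxAr mulmxA scalerA exprSr.
  have [k Lyk] : exists k, (y ^+ (p ^ k))%g \in L.
    have /p_natP[k Dk] := pML; exists k; have /subsetP nLM := normal_norm nsLM.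
    apply: coset_idr; first by rewrite nLM ?groupX.
    by rewrite morphX ?nLM // -Dk expg_cardG ?mem_quotient.
  have := cyk (p ^ k)%N; rewrite -cc ?envelop_sub_id //; set R := _ *m c.
  have nzR : R != 0.
    apply/eqP => R0; have [_ /eqP nzU _] := simU; apply: nzU.
    have c0 : c = 0.
      have My' : (y ^+ (p ^ k))%g \in M by rewrite groupX.
      by rewrite -[c]mul1mx -(repr_mx1 rM) -(mulVg (y ^+ (p ^ k))%g) repr_mxM ?groupV // -(mulmxA _ _ c) -/R R0 mulmx0.
    by rewrite -[U]mulmx1 -cc' c0 mul0mx mulmx0.
  move/eqP; rewrite -subr_eq0 -{1}(scale1r R) -scalerBl scaler_eq0 (negPf nzR) orbF.
  rewrite subr_eq0 eq_sym => /eqP bpk.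
  have b1 : b = 1.
    apply/eqP; rewrite -subr_eq0; have: (b - 1) ^+ (p ^ k) == 0.
      have pk : [pchar F].-nat (p ^ k)%N.
        by rewrite (eq_pnat _ (pcharf_eq charFp)) pnatX pnat_id ?(pcharf_prime charFp).
      by rewrite exprDn_pchar // exprNn_pchar // bpk expr1n subrr.
    by rewrite expf_eq0 => /andP[].
  by rewrite cy b1 scale1r.
have /is_scalar_mxP[a Dc] : is_scalar_mx c.
  exact: (homogeneous_center simW homW).
by rewrite rMm Dc mul_mx_scalar envelop_mxZ.
Qed.

End PQuotient.

(** * Restriction of a quasi-primitive representation to a Hall subgroup *)

Section Hall.

Variables (F : closedFieldType) (gT : finGroupType) (G : {group gT}) (n : nat).
Variables (rG : mx_representation F G n) (p : nat).
Hypotheses (charFp : p \in [pchar F]) (solG : solvable G).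

Definition spans (S : {set gT}) (A : 'M[F]_n) :=
  exists a : gT -> F, A = \sum_(y in S) a y *: rG y.

Lemma spans_id (S : {set gT}) x : x \in S -> spans S (rG x).
Proof.
move=> Sx; exists (fun y => (y == x)%:R); rewrite (bigD1 x) //= eqxx scale1r.
by rewrite big1 ?addr0 // => y /andP[_ /negPf->]; rewrite scale0r.
Qed.

Lemma spansD S A B : spans S A -> spans S B -> spans S (A + B).
Proof.
move=> [a ->] [b ->]; exists (fun y => a y + b y); rewrite -big_split /=.
by apply: eq_bigr => y _; rewrite scalerDl.
Qed.

Lemma spansZ S c A : spans S A -> spans S (c *: A).
Proof.
move=> [a ->]; exists (fun y => c * a y); rewrite scaler_sumr.
by apply: eq_bigr => y _; rewrite scalerA.
Qed.

Lemma spans_trans (S T : {set gT}) A :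
  spans S A -> {in S, forall x, spans T (rG x)} -> spans T A.
Proof.
move=> [a ->] ST; elim/big_rec: _ => [|x B Sx TB].
  by exists (fun=> 0); rewrite big1 // => y _; rewrite scale0r.
by apply: spansD TB; apply/spansZ/ST.
Qed.

Lemma spansM (S : {group gT}) A B :
  S \subset G -> spans S A -> spans S B -> spans S (A *m B).
Proof.
move=> /subsetP sSG [a ->] [b ->]; rewrite mulmx_suml.
elim/big_rec: _ => [|x C Sx SC].
  by exists (fun=> 0); rewrite big1 // => y _; rewrite scale0r.
apply: spansD SC; rewrite -scalemxAl; apply: spansZ; rewrite mulmx_sumr.
elim/big_rec: _ => [|y D Sy SD].
  by exists (fun=> 0); rewrite big1 // => z _; rewrite scale0r.
apply: spansD SD; rewrite -scalemxAr -repr_mxM ?sSG //.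
by apply/spansZ/spans_id/groupM.
Qed.

Definition homogeneous_on (N : {group gT}) := forall sNG : N \subset G,
  exists2 U, mxsimple (subg_repr rG sNG) U &
    (1%:M <= component_mx (subg_repr rG sNG) U)%MS.

Variable Y : {group gT}.
Hypotheses (hallY : p^'.-Hall(G) Y)
  (homG : forall N : {group gT}, N <| G -> homogeneous_on N).

(** Induction along a chief series of G.  A chief factor that is a p-group
adds nothing to the span by [p_quotient_envelop]; for one of order prime to p,
the group N is generated by the smaller term and N :&: Y. *)
Lemma spans_Hall (N : {group gT}) x : N <| G -> x \in N -> spans (N :&: Y) (rG x).
Proof.
have [k] := ubnP #|N|; elim: k => // k IHk in N x * => leNk nsNG Nx.
have sNG := normal_sub nsNG.
have [N1 | ntN] := eqVneq N 1%G.
  by move: Nx; rewrite N1 inE => /eqP->; apply: spans_id; rewrite !group1.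
have [L maxL _] : {L : {group gT} | maxnormal L N G & 1%G \subset L}.
  apply: maxgroup_exists; rewrite norms1 andbT proper1G; exact: ntN.
have [sLN nsLG] : L \proper N /\ L <| G.
  case/maxgroupP: maxL => /andP[prLN nLG] _; split=> //.
  by rewrite /normal nLG (subset_trans (proper_sub prLN)) ?normal_sub.
have sLN' := proper_sub sLN.
have nsLN : L <| N := normalS sLN' (normal_sub nsNG) nsLG.
have minNL : minnormal (N / L) (G / L).
  by apply: maxnormal_minnormal maxL; rewrite ?normal_norm.
have [|_ _] := minnormal_solvable minNL (quotientS _ (normal_sub nsNG)).
  exact: quotient_sol solG.
case/is_abelemP=> q q_pr abNL; have qNL := abelem_pgroup abNL.
have IH l : l \in L -> spans (N :&: Y) (rG l).
  move=> Ll; apply: spans_trans (IHk L l _ nsLG Ll) _.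
    exact: leq_trans (proper_card sLN) _.
  by move=> y LYy; apply/spans_id/(subsetP (setSI _ sLN')).
have [Dq | q'p] := eqVneq q p.
  rewrite Dq in qNL.
  have [U simU homU] := homG nsLG (subset_trans sLN' sNG).
  have [W simW homW] := homG nsNG sNG.
  have EL : (rG x \in enveloping_algebra_mx (subg_repr (subg_repr rG sNG) (normal_sub nsLN)))%MS.
    exact: (@p_quotient_envelop F gT N L n (subg_repr rG sNG) nsLN U simU homU p W
              charFp (abelem_abelian abNL) qNL simW homW x Nx).
  by have /envelop_mxP Ex := EL; exact: spans_trans Ex IH.
have defN : (L * (Y :&: N))%g = N.
  have hallNY := Hall_setI_normal nsNG hallY.
  apply: coprime_index_mulG; rewrite ?subsetIr //.
  rewrite -card_quotient ?normal_norm //; apply: (@pnat_coprime q) => //.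
  have /and3P[_ _] := hallNY; apply: sub_in_pnat => r _.
  by rewrite !inE negbK => /eqP->; rewrite eq_sym.
move: (Nx); rewrite -{1}defN => /mulsgP[l y Ll /setIP[Yy Ny] ->].
have sNYG : N :&: Y \subset G by rewrite subIset ?sNG.
have Gl := subsetP (subset_trans sLN' sNG) l Ll; have Gy := subsetP sNG y Ny.
rewrite repr_mxM //.
by apply: (spansM (S := (N :&: Y)%G)) => //; [apply: IH | apply: spans_id; rewrite inE Ny].
Qed.

(** The operators of Y span those of G. *)
Lemma Hall_irr (irrG : mx_irreducible rG) (sYG : Y \subset G) :
  mx_irreducible (subg_repr rG sYG).
Proof.
have [n_gt0 irr] := iffLR (mx_irrP rG) irrG; apply/mx_irrP; split=> // U modU nzU.
apply: irr => //; apply/mxmoduleP=> x Gx.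
have [a ->] := spans_Hall (normal_refl G) Gx.
rewrite mulmx_sumr summx_sub // => y /setIP[_ Yy]; rewrite -scalemxAr scalemx_sub //.
exact: (mxmoduleP modU).
Qed.

End Hall.

(** * Similarities glued from a system of imprimitivity *)

Section Blocks.

Variables (F : fieldType) (n : nat) (I : finType) (W : I -> 'M[F]_n).
Hypotheses (dirW : mxdirect (\sum_i W i)) (sumW : (\sum_i W i :=: 1%:M)%MS).

Let proj i := proj_mx (W i) (\sum_(j | j != i) W j)%MS.

Lemma proj_block i m (v : 'M_(m, n)) : (v <= W i)%MS -> v *m proj i = v.
Proof. by apply: proj_mx_id; move/mxdirect_sumsP: dirW; apply. Qed.

Lemma proj_block0 i j m (v : 'M_(m, n)) : j != i -> (v <= W j)%MS -> v *m proj i = 0.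
Proof.
move=> ij vj; apply: proj_mx_0; first by move/mxdirect_sumsP: dirW; apply.
exact: submx_trans vj (sumsmx_sup j ij (submx_refl _)).
Qed.

(** The sum of the t i composed with the projections. *)
Lemma glue_blocks (t : I -> 'M[F]_n) :
  {T : 'M[F]_n | forall i m (v : 'M_(m, n)), (v <= W i)%MS -> v *m T = v *m t i}.
Proof.
exists (\sum_i proj i *m t i) => i m v vi.
rewrite mulmx_sumr (bigD1 i) //= mulmxA proj_block // big1 ?addr0 // => j ji.
by rewrite mulmxA (proj_block0 _ vi) ?mul0mx // eq_sym.
Qed.

Lemma eq_on_blocks (A B : 'M[F]_n) : (forall i, W i *m A = W i *m B) -> A = B.
Proof.
move=> AB; apply/eqP; rewrite -subr_eq0 -[_ - _]mul1mx; apply/eqP/sub_kermxP.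
rewrite -sumW; apply/sumsmx_subP=> i _; apply/sub_kermxP.
by rewrite mulmxBr AB subrr.
Qed.

Lemma blocks_unitmx (B : I -> 'M[F]_n) :
    (\sum_i B i :=: 1%:M)%MS -> (forall i, \rank (W i) = \rank (B i)) ->
  exists2 T : 'M[F]_n, T \in unitmx & forall i, (W i *m T :=: B i)%MS.
Proof.
move=> sumB eqr; have /fin_all_exists[t Dt] i : exists t, (W i *m t :=: B i)%MS.
  by have [t _ Dt] := eq_rank_unitmx (eqr i); exists t; apply: eqmx_sym.
have [T HT] := glue_blocks t; exists T => [|i]; last by rewrite (HT i).
rewrite -row_full_unit -sub1mx -sumB; apply/sumsmx_subP=> i _.
by rewrite -(Dt i) -HT ?submxMl.
Qed.

Variables (gT : finGroupType) (G : {group gT}).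
Variables (rG : mx_representation F G n) (to : action G I).
Hypothesis actW : forall i g, g \in G -> (W i *m rG g :=: W (to i g))%MS.
Variables (x : gT) (k : nat).
Hypotheses (Gx : x \in G) (co_k : coprime k #[x]).
Hypothesis blockS : forall i, exists S : 'M[F]_n, (W i *m S :=: W i)%MS /\
  {in <[x]>, forall y, to i y = i -> W i *m rG y *m S = W i *m S *m rG (y ^+ k)%g}.

(** Pick a representative r i in each orbit of the cyclic group of x on the
blocks, and transport the map S (r i) to the block i by an element h of this
group taking r i to i, in the form rG h^-1 *m S (r i) *m rG (h ^+ k).  Because
S (r i) intertwines y and y ^+ k for y in the stabiliser, the result does not
depend on h; replacing h by h * x shows that the maps on the blocks glue to an
operator intertwining x and x ^+ k.  It is surjective since k is prime to the
order of x, so that h ^+ k runs over the whole group with h. *)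
Lemma block_similar : exists2 T : 'M[F]_n, T \in unitmx & T *m rG (x ^+ k)%g = rG x *m T.
Proof.
have sCG : <[x]> \subset G by rewrite cycle_subG.
have GC y : y \in <[x]> -> y \in G by apply: (subsetP sCG).
have abC := cycle_abelian x.
have Wsub m (v : 'M_(m, n)) (A B : 'M_n) i : (v <= W i)%MS -> W i *m A = W i *m B -> v *m A = v *m B.
  by case/submxP=> D -> AB; rewrite -!mulmxA AB.
have /fin_all_exists[S HS] := blockS.
pose r i := odflt i [pick j in orbit to <[x]> i].
have r_orb i : r i \in orbit to <[x]> i.
  by rewrite /r; case: pickP => [//|/(_ i)]; rewrite orbit_refl.
have r_act i y : y \in <[x]> -> r (to i y) = r i.
  move=> Cy; rewrite /r (eq_pick (Q := mem (orbit to <[x]> i))); last first.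
    by move=> j; rewrite (orbit_act_in to i sCG Cy).
  by case: pickP => // /(_ i); rewrite inE orbit_refl.
have /fin_all_exists[g Hg] i : exists g, g \in <[x]> /\ to (r i) g = i.
  have := r_orb i; rewrite (orbit_in_sym to sCG) => /orbitP[g Cg Dg].
  by exists g.
pose s i h := rG h^-1%g *m S (r i) *m rG (h ^+ k)%g.
have [T HT] := glue_blocks (fun i => s i (g i)).
have indep i h : h \in <[x]> -> to (r i) h = i -> W i *m T = W i *m s i h.
  move=> Ch Dh; rewrite (HT i) //; have [Cg Dg] := Hg i; rewrite /s.
  pose y := (h * (g i)^-1)%g.
  have Cy : y \in <[x]> by rewrite groupM ?groupV.
  have ry : to (r i) y = r i.
    by rewrite /y actMin ?groupV ?GC // Dh -[RHS](actKin to (GC _ Cg)) Dg.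
  have [_ Sy] := HS (r i).
  have wr : (W i *m rG h^-1%g <= W (r i))%MS.
    by rewrite actW ?groupV ?GC // -(actKin to (GC _ Ch) (r i)) Dh.
  have Dv : W i *m rG (g i)^-1%g = W i *m rG h^-1%g *m rG y.
    by rewrite -mulmxA -repr_mxM ?groupV ?GC // /y mulKg.
  rewrite !mulmxA Dv.
  have := Wsub _ _ (rG y *m S (r i)) (S (r i) *m rG (y ^+ k)%g) _ wr.
  rewrite !mulmxA => ->; last exact: Sy.
  rewrite -(mulmxA _ (rG (y ^+ k)%g)) -repr_mxM ?groupX ?GC //.
  rewrite -expgMn; last by apply: (centsP abC).
  by rewrite /y mulgKV.
exists T; last first.
  apply: eq_on_blocks => i; have [Cg Dg] := Hg i.
  have Cgx : (g i * x)%g \in <[x]> by rewrite groupM ?cycle_id.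
  have Dgx : to (r (to i x)) (g i * x)%g = to i x.
    by rewrite r_act ?cycle_id // actMin ?(GC _ Cg) // Dg.
  have := indep _ _ Cgx Dgx; rewrite (mulmxA _ (rG x)) mulmxA => E.
  have Wx : (W i *m rG x <= W (to i x))%MS by rewrite actW.
  rewrite (Wsub _ _ _ _ _ Wx E) (indep i (g i)) // /s r_act ?cycle_id //.
  rewrite invMg expgMn; last by apply: (centsP abC); rewrite ?cycle_id.
  have Gg := GC _ Cg; rewrite !repr_mxM ?groupX ?groupV // !mulmxA.
  by rewrite (repr_mxK rG Gx).
rewrite -row_full_unit -sub1mx -sumW; apply/sumsmx_subP=> i _.
have [Cg Dg] := Hg i.
(* Reaching i through h with h ^+ k = g i shows that W i is in the image. *)
pose l := expg_invn <[x]> k.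
pose h := (g i ^+ l)%g; pose i' := to (r i) h.
have Ch : h \in <[x]> by rewrite groupX.
have hk : (h ^+ k)%g = g i.
  have co_xk : coprime #|<[x]>| k by rewrite coprime_sym.
  by rewrite -expgM mulnC expgM expgK.
have ri' : r i' = r i.
  by rewrite /i' r_act // -{2}Dg r_act.
have := indep i' h Ch; rewrite ri' => /(_ erefl); rewrite /s hk ri' => E.
apply: submx_trans (submxMl (W i') T); rewrite E !mulmxA.
have [Sr _] := HS (r i).
have E1 : (W i' *m rG h^-1%g :=: W (r i))%MS.
  by apply: eqmx_trans (actW _ _) _; rewrite ?groupV ?GC // /i' actKin ?GC.
rewrite (eqmxMr _ (eqmxMr _ E1)) (eqmxMr _ Sr) actW ?GC // Dg.
exact: submx_refl.
Qed.

End Blocks.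

(** * Convolution operators and their ranks *)

(** In a rank factorisation A = C *m R, the product R *m C is the scalar c. *)
Lemma mxtrace_scaled_idem (F : fieldType) n (A : 'M[F]_n) c :
  A *m A = c *: A -> \tr A = c *+ \rank A.
Proof.
move=> AA; move: (mulmx_base A) (col_base_full A) (row_base_free A).
move: (col_base A) (row_base A); move: (\rank A) => r C R D.
move=> /row_fullP[P PC] /row_freeP[Q RQ].
have RC : R *m C = c%:M.
  transitivity (P *m (C *m R) *m (C *m R) *m Q).
    by rewrite !mulmxA PC mul1mx -mulmxA RQ mulmx1.
  rewrite D -(mulmxA P A A) AA -scalemxAr -scalemxAl -D.
  by rewrite -!mulmxA RQ mulmx1 PC scalemx1.
by rewrite -{1}D mxtrace_mulC RC mxtrace_scalar.
Qed.

(** A nonvanishing minor of the image under g comes from a minor of A, which is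
itself nonzero and so stays nonzero under the injective f. *)
Lemma mxrank_map_le (R : comNzRingType) (K L : fieldType) (f : {rmorphism R -> K})
    (g : {rmorphism R -> L}) n (A : 'M[R]_n) :
  injective f -> (\rank (map_mx g A) <= \rank (map_mx f A))%N.
Proof.
move=> injf; set B := map_mx g A; set C := map_mx f A.
pose s := maxrankfun B.
have full1 : row_full (rowsub s B)^T by rewrite /row_full mxrank_tr; apply: maxrowsub_free.
pose t := fullrankfun full1.
have detB : \det (rowsub t (rowsub s B)^T) != 0.
  by rewrite -unitfE -unitmxE fullrowsub_unit.
have detC : \det (rowsub t (rowsub s C)^T) != 0.
  have DM (L' : fieldType) (h : {rmorphism R -> L'}) :
      rowsub t (rowsub s (map_mx h A))^T = map_mx h (rowsub t (rowsub s A)^T).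
    by apply/matrixP=> i j; rewrite !mxE.
  move: detB; rewrite /B /C !DM !det_map_mx; apply: contra_neq => fd0.
  by rewrite -[X in g X](_ : 0 = _) ?rmorph0 //; apply: injf; rewrite fd0 rmorph0.
have le1 (m k l : nat) (h : 'I_k -> 'I_m) (M : 'M[K]_(m, l)) : (\rank (rowsub h M) <= \rank M)%N.
  by rewrite mxrankS //; apply/row_subP => i; rewrite row_rowsub row_sub.
apply: leq_trans (le1 _ _ _ s C); rewrite -(mxrank_tr (rowsub s C)); apply: leq_trans (le1 _ _ _ t _).
have : rowsub t (rowsub s C)^T \in unitmx by rewrite unitmxE unitfE.
by move/mxrank_unit/esym/eq_leq.
Qed.

Section Convolution.

Variables (gT : finGroupType) (Y : {group gT}).
Local Notation g := #|Y|.

Section Ring.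
Variable R : comNzRingType.

(** The matrix by which the group algebra element with coefficients a acts on
the regular module. *)
Definition rmx (a : gT -> R) : 'M[R]_g :=
  \matrix_(i, j) a ((enum_val i)^-1 * enum_val j)%g.

Definition conv (a b : gT -> R) z := \sum_(y in Y) a y * b (y^-1 * z)%g.

Lemma rmxM a b : rmx a *m rmx b = rmx (conv a b).
Proof.
apply/matrixP=> i j; rewrite !mxE /conv.
have Yi := enum_valP i.
rewrite (reindex_inj (mulgI (enum_val i)^-1)%g) /=.
rewrite (eq_bigl (mem Y)) => [|y]; last by rewrite groupMl ?groupV.
rewrite [RHS]big_enum_val /=; apply: eq_bigr => l _.
by rewrite !mxE invMg invgK mulgA mulgK.
Qed.

Lemma mxtrace_rmx a : \tr (rmx a) = a 1%g *+ g.
Proof.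
rewrite /mxtrace (eq_bigr (fun=> a 1%g)) ?sumr_const ?card_ord // => i _.
by rewrite mxE mulVg.
Qed.

End Ring.

Section Rep.
Variables (F : fieldType) (d : nat) (rV : mx_representation F Y d).

(** The action on a module of the group algebra element with coefficients a. *)
Definition rop (a : gT -> F) : 'M[F]_d := \sum_(y in Y) a y *: rV y.

Lemma ropM a b : rop (conv a b) = rop a *m rop b.
Proof.
rewrite /rop mulmx_suml.
transitivity (\sum_(z in Y) \sum_(y in Y) (a y * b (y^-1 * z)%g) *: rV z).
  by apply: eq_bigr => z Yz; rewrite /conv scaler_suml.
rewrite exchange_big /=; apply: eq_bigr => y Yy.
rewrite mulmx_sumr (reindex_inj (mulgI y)) /=.
apply: eq_big => [z|z]; rewrite groupMl // => Yz.
by rewrite mulKg -scalemxAl -scalemxAr scalerA repr_mxM.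
Qed.

Lemma lin_mulmxrM m n p q (A : 'M[F]_(n, p)) (B : 'M[F]_(p, q)) :
  @lin_mulmxr F m n p A *m @lin_mulmxr F m p q B = lin_mulmxr (A *m B).
Proof.
apply/row_matrixP=> i; rewrite row_mul !rowE -[delta_mx 0 i]vec_mxK.
by rewrite !mul_vec_lin /= mulmxA.
Qed.

Lemma lin_mulmxr1 m n : @lin_mulmxr F m n n 1%:M = 1%:M.
Proof.
apply/row_matrixP=> i; rewrite !rowE -[delta_mx 0 i]vec_mxK.
by rewrite mul_vec_lin /= !mulmx1.
Qed.

Lemma mxrank_lin_mulmxr m (B : 'M[F]_d) :
  (m * \rank B <= \rank (@lin_mulmxr F m d d B))%N.
Proof.
rewrite -{2}(mulmx_base B).
move: (col_base_full B) (row_base_free B); move: (col_base B) (row_base B).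
move: (\rank B) => r C R /row_fullP[P PC] /row_freeP[Q RQ].
rewrite -lin_mulmxrM.
have fullC : row_full (@lin_mulmxr F m d r C).
  by apply/row_fullP; exists (lin_mulmxr P); rewrite lin_mulmxrM PC lin_mulmxr1.
have freeR : row_free (@lin_mulmxr F m r d R).
  by apply/row_freeP; exists (lin_mulmxr Q); rewrite lin_mulmxrM RQ lin_mulmxr1.
by rewrite mxrankMfree // (eqP fullC).
Qed.

(** The matrix algebra is a quotient of the regular module when the module is
absolutely irreducible; multiplication by an operator B has rank
d * \rank B on it. *)
Lemma mxrank_rop (a : gT -> F) : mx_absolutely_irreducible rV ->
  (d * \rank (rop a) <= \rank (rmx a))%N.
Proof.
case/andP=> d_gt0 fullK; set K := enveloping_algebra_mx rV in fullK.
apply: leq_trans (mxrank_lin_mulmxr d (rop a)) _.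
have DK : rmx a *m K = K *m lin_mulmxr (rop a).
  apply/row_matrixP=> i; rewrite !row_mul rowK mul_vec_lin /=.
  rewrite mulmx_sum_row mulmx_sumr (reindex_inj (mulgI (enum_val i)^-1)%g) /=.
  rewrite (eq_bigl (mem Y)) => [|y]; last by rewrite groupMl ?groupV ?enum_valP.
  rewrite [in RHS]big_enum_val linear_sum; apply: eq_bigr => j _ /=.
  rewrite rowK !mxE -scalemxAr linearZ /= -repr_mxM ?groupM ?groupV ?enum_valP //.
  by rewrite mulKVg.
by rewrite -(eqmxMfull _ fullK) -DK mxrankM_maxl.
Qed.

End Rep.
End Convolution.

(** * Reduction of algebraic integers and character idempotents *)

Section Reduction.

Variables (F : fieldType) (red : {rmorphism algint -> F}).

(** The value 0 outside the ring of algebraic integers makes the reduction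
total on algC. *)
Definition algint_of (z : algC) : algint := insubd 0 z.

Lemma algint_ofK z : z \in Aint -> algint_val (algint_of z) = z.
Proof. exact: insubdK. Qed.

Lemma algint_of_val (z : algint) : algint_of (algint_val z) = z.
Proof. exact: valKd. Qed.

Lemma algint_ofD x y : x \in Aint -> y \in Aint -> algint_of (x + y) = algint_of x + algint_of y.
Proof.
by move=> Ax Ay; apply: val_inj; rewrite rmorphD /= !algint_ofK ?rpredD.
Qed.

Lemma algint_ofM x y : x \in Aint -> y \in Aint -> algint_of (x * y) = algint_of x * algint_of y.
Proof.
by move=> Ax Ay; apply: val_inj; rewrite rmorphM /= !algint_ofK ?rpredM.
Qed.

Lemma algint_of_nat n : algint_of n%:R = n%:R.
Proof. by apply: val_inj; rewrite rmorph_nat /= algint_ofK ?rpred_nat. Qed.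

Definition redC z := red (algint_of z).

Lemma redCD x y : x \in Aint -> y \in Aint -> redC (x + y) = redC x + redC y.
Proof. by move=> Ax Ay; rewrite /redC algint_ofD ?rmorphD. Qed.

Lemma redCM x y : x \in Aint -> y \in Aint -> redC (x * y) = redC x * redC y.
Proof. by move=> Ax Ay; rewrite /redC algint_ofM ?rmorphM. Qed.

Lemma redC_nat n : redC n%:R = n%:R.
Proof. by rewrite /redC algint_of_nat rmorph_nat. Qed.

Lemma redC0 : redC 0 = 0. Proof. exact: (redC_nat 0). Qed.
Lemma redC1 : redC 1 = 1. Proof. exact: (redC_nat 1). Qed.

Lemma redC_sum I (r : seq I) (P : pred I) (E : I -> algC) :
  (forall i, P i -> E i \in Aint) ->
  redC (\sum_(i <- r | P i) E i) = \sum_(i <- r | P i) redC (E i).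
Proof.
move=> AE; suff [] : (\sum_(i <- r | P i) E i \in Aint) /\
  redC (\sum_(i <- r | P i) E i) = \sum_(i <- r | P i) redC (E i) by [].
elim/big_rec2: _ => [|i x y Pi [Ay <-]]; first by rewrite redC0 rpred0.
by rewrite rpredD ?AE // redCD ?AE.
Qed.

Lemma redCX x n : x \in Aint -> redC (x ^+ n) = redC x ^+ n.
Proof.
move=> Ax; elim: n => [|n IHn]; first by rewrite !expr0 redC1.
by rewrite !exprS redCM ?rpredX // IHn.
Qed.

End Reduction.

Section CharacterIdempotents.
Variables (gT : finGroupType) (Y : {group gT}).

(** Up to the factor #|Y|, the coefficients of the central idempotent of the
group algebra attached to i; no denominators occur, so that it can be reduced
modulo p. *)
Definition irr_elt (i : Iirr Y) (y : gT) : algC := 'chi_i 1%g * 'chi_i y^-1%g.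
(** Up to the factor #[x], the coefficients of the idempotent of the group
algebra of <[x]> attached to l; they vanish outside <[x]>, where characters
are extended by 0. *)
Definition lin_elt (x : gT) (l : Iirr <[x]>) (y : gT) : algC := 'chi_l y^-1%g.

(** This is the generalised orthogonality relation. *)
Lemma conv_irr_elt i j z : z \in Y ->
  conv Y (irr_elt i) (irr_elt j) z = #|Y|%:R * irr_elt i z *+ (i == j).
Proof.
move=> Yz; have := generalized_orthogonality_relation z^-1%g j i.
have nz := neq0CG Y; move/(canRL (mulKf (invr_neq0 nz))); rewrite invrK => E.
rewrite /conv /irr_elt.
transitivity ('chi_i 1%g * 'chi_j 1%g * \sum_(y in Y) 'chi_j (y * z^-1)%g * 'chi_i y^-1%g).
  rewrite mulr_sumr; apply: eq_bigr => y Yy.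
  have -> : 'chi_j (y^-1 * z)^-1%g = 'chi_j (y * z^-1)%g.
    by rewrite invMg invgK -(@cfunJ _ _ 'chi_j (z^-1 * y)%g z^-1%g) ?groupV // conjgE invgK !mulgA mulgV mul1g.
  by ring.
rewrite E eq_sym; case: eqP => [->|_]; last by rewrite mul0r !mulr0 mulr0n.
by rewrite mul1r mulr1n; field; rewrite irr1_neq0.
Qed.

Lemma conv_irr_eltC i (b : gT -> algC) z : z \in Y ->
  conv Y (irr_elt i) b z = conv Y b (irr_elt i) z.
Proof.
move=> Yz; rewrite /conv [RHS](reindex_inj invg_inj) /=.
rewrite [RHS](reindex_inj (mulgI z^-1)%g) /=.
apply: eq_big => [y|y]; first by rewrite groupV groupMl ?groupV.
move=> Yy; rewrite mulrC invMg !invgK; congr (b _ * _).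
rewrite /irr_elt; congr (_ * _); rewrite -(@cfunJ _ _ 'chi_i _ z) //.
by congr ('chi_i _); rewrite conjgE !invMg !invgK !mulgA.
Qed.

Lemma conv_lin_elt x l z : x \in Y ->
  conv Y (lin_elt (x := x) l) (lin_elt l) z = #[x]%:R * lin_elt l z.
Proof.
move=> Yx; have sxY : <[x]> \subset Y by rewrite cycle_subG.
have linl : 'chi_l \is a linear_char by apply/irr_cyclic_lin/cycle_cyclic.
rewrite /conv (bigID (mem <[x]>)) /= [X in _ + X]big1 ?addr0; last first.
  by move=> y /andP[_ x'y]; rewrite /lin_elt cfun0 ?mul0r // groupV.
rewrite (eq_bigl (mem <[x]>)) => [|y]; last first.
  by rewrite andb_idl //; apply: (subsetP sxY).
have [xz | x'z] := boolP (z \in <[x]>); last first.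
  rewrite big1 ?[lin_elt l z]/lin_elt ?cfun0 ?mulr0 ?groupV // => y xy.
  by rewrite /lin_elt [X in _ * X]cfun0 ?mulr0 // groupV groupMl ?groupV.
rewrite (eq_bigr (fun=> lin_elt l z)) => [|y xy].
  by rewrite sumr_const mulr_natl.
by rewrite /lin_elt mulrC -lin_charM ?groupV ?groupM ?groupV // invMg invgK mulgK.
Qed.

Definition irr_mult x i (l : Iirr <[x]>) := Num.truncn '['Res[<[x]>] 'chi[Y]_i, 'chi_l].

Lemma irr_multE x i l : (irr_mult i l)%:R = '['Res[<[x]>] 'chi_i, 'chi_l].
Proof. by rewrite truncnK // Cnat_cfdot_char ?cfRes_char ?irr_char. Qed.

Definition chi_deg i := Num.truncn ('chi[Y]_i 1%g).

Lemma chi_degE i : (chi_deg i)%:R = 'chi_i 1%g.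
Proof. by rewrite truncnK // Cnat_irr1. Qed.

Definition iso_elt x i (l : Iirr <[x]>) := conv Y (irr_elt i) (lin_elt l).

(** The two commuting idempotents multiply to an idempotent, and its trace,
read on the coefficient at 1, is the rank. *)
Lemma mxrank_iso_elt x i (l : Iirr <[x]>) : x \in Y ->
  \rank (rmx Y (iso_elt i l)) = (chi_deg i * irr_mult i l)%N.
Proof.
move=> Yx; have sxY : <[x]> \subset Y by rewrite cycle_subG.
have linl : 'chi_l \is a linear_char by apply/irr_cyclic_lin/cycle_cyclic.
pose E := rmx Y (irr_elt i); pose D := rmx Y (lin_elt l).
have EE : E *m E = #|Y|%:R *: E.
  rewrite rmxM -/E; apply/matrixP=> a b; rewrite !mxE conv_irr_elt ?eqxx //.
  by rewrite groupM ?groupV ?enum_valP.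
have DD : D *m D = #[x]%:R *: D.
  by rewrite rmxM; apply/matrixP=> a b; rewrite !mxE conv_lin_elt.
have ED : E *m D = D *m E.
  rewrite !rmxM; apply/matrixP=> a b; rewrite !mxE conv_irr_eltC //.
  by rewrite groupM ?groupV ?enum_valP.
have AA : (E *m D) *m (E *m D) = (#|Y|%:R * #[x]%:R) *: (E *m D).
  rewrite mulmxA -(mulmxA E D E) -ED mulmxA EE -!mulmxA DD.
  by rewrite -scalemxAl -!scalemxAr scalerA.
have := mxtrace_scaled_idem AA; rewrite rmxM mxtrace_rmx.
have -> : conv Y (irr_elt i) (lin_elt l) 1%g = 'chi_i 1%g * (#[x]%:R * '['Res[<[x]>] 'chi_i, 'chi_l]).
  rewrite cfdotC_char ?cfRes_char ?irr_char // cfdotE mulVKf ?neq0CG //.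
  rewrite /conv mulr_sumr (bigID (mem <[x]>)) /= [X in _ + X]big1 ?addr0; last first.
    by move=> y /andP[_ x'y]; rewrite /lin_elt [X in _ * X]cfun0 ?mulr0 // mulg1 invgK.
  apply: eq_big => [y|y /andP[_ xy]]; first by rewrite andb_idl //; apply: (subsetP sxY).
  rewrite /irr_elt /lin_elt mulg1 invgK (cfResE _ sxY) // -irr_inv.
  by ring.
rewrite -[conv _ _ _]/(iso_elt i l) -(chi_degE i) -(irr_multE i l).
rewrite -[LHS]mulr_natr -[RHS]mulr_natr -!natrM => /eqP.
rewrite eqC_nat => /eqP H.
have gt0 : (0 < #|Y| * #[x])%N by rewrite muln_gt0 cardG_gt0 order_gt0.
apply/eqP; rewrite -(eqn_pmul2l gt0) -H.
by rewrite mulnC (mulnCA (chi_deg i)) mulnA.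
Qed.

End CharacterIdempotents.

(** * Eigenvalues of representations of order prime to the characteristic *)

Lemma leq_sum_eq (I : finType) (a b : I -> nat) :
  (forall i, a i <= b i)%N -> (\sum_i b i <= \sum_i a i)%N -> a =1 b.
Proof.
move=> le_ab le_ba i; apply/eqP; move: i; apply/forallP.
have [le_s <-] := leqif_sum (fun i (_ : true) => leqif_eq (le_ab i)).
by rewrite eqn_leq le_s.
Qed.

Section Lift.

Variables (F : closedFieldType) (red : {rmorphism algint -> F}).
Variables (gT : finGroupType) (Y : {group gT}).
Hypothesis F'Y : [pchar F]^'.-group Y.

Local Notation redC := (redC red).

Lemma Aint_irr_elt i y : irr_elt (Y := Y) i y \in Aint.
Proof. by rewrite rpredM ?Aint_irr. Qed.

Lemma Aint_lin_elt (x : gT) (l : Iirr <[x]>) (y : gT) : lin_elt l y \in Aint.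
Proof. exact: Aint_irr. Qed.

Lemma redC_conv a b z : (forall y, a y \in Aint) -> (forall y, b y \in Aint) ->
  redC (conv Y a b z) = conv Y (redC \o a) (redC \o b) z.
Proof.
move=> Aa Ab; rewrite /conv redC_sum => [|y _]; last by rewrite rpredM.
by apply: eq_bigr => y _; rewrite /= redCM.
Qed.

Lemma sum_irr_elt y : \sum_i irr_elt (Y := Y) i y = #|Y|%:R *+ (y == 1%g).
Proof.
have := congr1 (fun f : 'CF(Y) => f y^-1%g) (cfReg_sum Y).
rewrite /= cfRegE sum_cfunE (can2_eq invgK invgK) invg1 => ->.
by apply: eq_bigr => i _; rewrite cfunE.
Qed.

Lemma sum_lin_elt (x y : gT) : \sum_(l : Iirr <[x]>) lin_elt l y = #[x]%:R *+ (y == 1%g).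
Proof.
have := congr1 (fun f : 'CF(<[x]>) => f y^-1%g) (cfReg_sum <[x]>).
rewrite /= cfRegE sum_cfunE (can2_eq invgK invgK) invg1 => ->.
apply: eq_bigr => i _; rewrite cfunE lin_char1 ?mul1r //.
exact/irr_cyclic_lin/cycle_cyclic.
Qed.

Section OneRep.
Variables (d : nat) (rV : mx_representation F Y d).
Hypothesis irrV : mx_irreducible rV.

Let absV : mx_absolutely_irreducible rV.
Proof. exact: group_closure_closed_field. Qed.

(** The reduction modulo p of the idempotent of i, acting on the module.  On an
irreducible module these are scalars, and exactly one of them is nonzero; the
corresponding i is the lift of the module. *)
Definition irr_op i := rop rV (redC \o irr_elt (Y := Y) i).

Definition chi_eigenspace x (l : Iirr <[x]>) : 'M[F]_d := eigenspace (rV x) (redC ('chi_l x)).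

Lemma rop_sum (I : finType) (a : I -> gT -> F) :
  \sum_i rop rV (a i) = rop rV (fun y => \sum_i a i y).
Proof.
rewrite exchange_big; apply: eq_bigr => y Yy; by rewrite scaler_suml.
Qed.

Lemma rop_delta1 (c : F) : rop rV (fun y => c *+ (y == 1%g)) = c%:M.
Proof.
rewrite /rop (bigD1 1%g) //= eqxx mulr1n repr_mx1 scalemx1.
by rewrite big1 ?addr0 // => y /andP[_ /negPf->]; rewrite mulr0n scale0r.
Qed.

Lemma irr_op_sum : \sum_i irr_op i = #|Y|%:R%:M.
Proof.
rewrite rop_sum -rop_delta1; apply: eq_bigr => y _; congr (_ *: _).
rewrite -redC_sum => [|i _]; last exact: Aint_irr_elt.
by rewrite sum_irr_elt; case: eqP => _; rewrite ?mulr1n ?mulr0n ?redC_nat ?redC0.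
Qed.

Lemma irr_op_mul i j : irr_op i *m irr_op j = (#|Y|%:R *: irr_op i) *+ (i == j).
Proof.
rewrite -ropM /irr_op /rop.
transitivity (\sum_(y in Y) (#|Y|%:R * redC (irr_elt i y)) *+ (i == j) *: rV y).
  apply: eq_bigr => y Yy; congr (_ *: _).
  rewrite -redC_conv; try exact: Aint_irr_elt.
  rewrite conv_irr_elt //; case: eqP => _; rewrite ?mulr1n ?mulr0n ?redC0 //.
  by rewrite redCM ?rpred_nat ?Aint_irr_elt // redC_nat.
rewrite scaler_sumr; case: (i == j); last by rewrite big1 ?mulr0n // => y _; rewrite mulr0n scale0r.
by rewrite mulr1n; apply: eq_bigr => y _; rewrite mulr1n scalerA.
Qed.

Lemma irr_op_scalar i : is_scalar_mx (irr_op i).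
Proof.
apply: (mx_abs_irr_cent_scalar absV); apply/centgmxP=> z Yz.
rewrite /irr_op /rop mulmx_suml mulmx_sumr [RHS](reindex_inj (conjg_inj z)) /=.
apply: eq_big => [y|y]; rewrite ?groupJr // => Yy.
rewrite -scalemxAl -scalemxAr -!repr_mxM ?groupJ // -conjgC; congr (_ *: _).
by rewrite /= /irr_elt -conjVg cfunJ.
Qed.

Lemma natY_neq0 : #|Y|%:R != 0 :> F.
Proof. by rewrite natf_neq0_pchar. Qed.

Lemma order_neq0 x : x \in Y -> #[x]%:R != 0 :> F.
Proof.
by move=> Yx; rewrite natf_neq0_pchar; apply: pnat_dvd (order_dvdG Yx) F'Y.
Qed.

Lemma d_gt0 : (0 < d)%N. Proof. by case/andP: absV. Qed.

Lemma irr_op_exists : exists i, irr_op i != 0.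
Proof.
apply/existsP; apply: contraT; rewrite negb_exists => /forallP e0.
have := irr_op_sum; rewrite big1 => [/esym/eqP|i _]; last by apply/eqP; rewrite -[_ == _]negbK.
rewrite -scalemx1 scaler_eq0 (negPf natY_neq0) -mxrank_eq0 mxrank1 /=.
by rewrite eqn0Ngt d_gt0.
Qed.

Lemma irr_op_uniq i j : irr_op i != 0 -> irr_op j != 0 -> i = j.
Proof.
move=> ei ej; apply: contraTeq ej => /negPf ij.
have [a Da] := is_scalar_mxP (irr_op_scalar i).
have := irr_op_mul i j; rewrite ij mulr0n Da mul_scalar_mx => /eqP.
rewrite scaler_eq0 => /orP[/eqP a0 |/eqP->]; last by rewrite eqxx.
by move: ei; rewrite Da a0 -scalemx1 scale0r eqxx.
Qed.

Section OneElement.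
Variables (x : gT) (Yx : x \in Y).

Let sxY : <[x]> \subset Y. Proof. by rewrite cycle_subG. Qed.

Let lin_cycle (l : Iirr <[x]>) : 'chi_l \is a linear_char.
Proof. exact/irr_cyclic_lin/cycle_cyclic. Qed.

Let rop_cycle (a : gT -> F) : (forall y, y \notin <[x]> -> a y = 0) ->
  rop rV a = \sum_(y in <[x]>) a y *: rV y.
Proof.
move=> a0; rewrite /rop (bigID (mem <[x]>)) /= addrC big1 => [|y /andP[_ x'y]].
  by rewrite add0r; apply: eq_bigl => y; rewrite andb_idl //; apply: (subsetP sxY).
by rewrite a0 ?scale0r.
Qed.

Let redC_lin0 (l : Iirr <[x]>) y : y \notin <[x]> -> redC (lin_elt l y) = 0.
Proof. by move=> x'y; rewrite /lin_elt cfun0 ?redC0 // groupV. Qed.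

Lemma eig_cycle (l : Iirr <[x]>) y :
  y \in <[x]> -> chi_eigenspace l *m rV y = redC ('chi_l y) *: chi_eigenspace l.
Proof.
case/cycleP=> j ->; rewrite lin_charX ?cycle_id // redCX ?Aint_irr //.
have eigx : chi_eigenspace l *m rV x = redC ('chi_l x) *: chi_eigenspace l by apply/eigenspaceP.
elim: j => [|j IHj]; first by rewrite expg0 expr0 repr_mx1 mulmx1 scale1r.
by rewrite expgSr exprSr repr_mxM ?groupX // mulmxA IHj -scalemxAl eigx scalerA.
Qed.

Lemma eig_rop (l : Iirr <[x]>) :
  chi_eigenspace l *m rop rV (redC \o lin_elt l) = #[x]%:R *: chi_eigenspace l.
Proof.
rewrite rop_cycle; last exact: redC_lin0.
rewrite mulmx_sumr (eq_bigr (fun=> chi_eigenspace l)) => [|y xy].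
  by rewrite sumr_const scaler_nat.
rewrite -scalemxAr eig_cycle // scalerA -redCM ?Aint_irr //.
by rewrite -lin_charM ?groupV // mulVg lin_char1 // redC1 scale1r.
Qed.

Lemma rop_lin_eig (l : Iirr <[x]>) : (rop rV (redC \o lin_elt l) <= chi_eigenspace l)%MS.
Proof.
apply/eigenspaceP; rewrite rop_cycle; last exact: redC_lin0.
rewrite mulmx_suml scaler_sumr [RHS](reindex_inj (mulIg x)) /=.
apply: eq_big => [y|y xy]; first by rewrite groupMr ?cycle_id.
have Yy := subsetP sxY y xy.
rewrite -scalemxAl -repr_mxM // scalerA -redCM ?Aint_irr //; congr (redC _ *: _).
rewrite -lin_charM ?groupV ?groupM ?cycle_id // invMg mulgA mulgV mul1g //.
Qed.

Lemma sum_eig : (1%:M <= \sum_(l : Iirr <[x]>) chi_eigenspace l)%MS.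
Proof.
have nz := order_neq0 Yx.
have <- : (#[x]%:R)^-1 *: \sum_(l : Iirr <[x]>) rop rV (redC \o lin_elt l) = 1%:M.
  rewrite rop_sum; apply: (canLR (scalerK nz)); rewrite scalemx1 -rop_delta1.
  apply: eq_bigr => y _; congr (_ *: _).
  rewrite -redC_sum => [|l _]; last exact: Aint_lin_elt.
  by rewrite sum_lin_elt; case: eqP => _; rewrite ?mulr1n ?mulr0n ?redC_nat ?redC0.
rewrite scalemx_sub // summx_sub // => l _.
by rewrite (sumsmx_sup l) ?rop_lin_eig.
Qed.

(** The image of the reduction of [iso_elt i l] contains the eigenspace, as the
factor [irr_elt i] acts as a nonzero scalar.  Its rank is bounded through
the rank on the regular module, which can only drop when passing from
characteristic 0 to the residue field. *)
Lemma eig_le i (l : Iirr <[x]>) :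
  irr_op i != 0 -> (d * \rank (chi_eigenspace l) <= chi_deg i * irr_mult i l)%N.
Proof.
move=> nzi; have [a Da] := is_scalar_mxP (irr_op_scalar i).
have nza : a != 0 by apply: contraNneq nzi => a0; rewrite Da a0 -scalemx1 scale0r.
rewrite -(mxrank_iso_elt i l Yx).
have AI y : iso_elt i l y \in Aint.
  rewrite rpred_sum // => z _; rewrite rpredM ?Aint_irr_elt //.
  exact: Aint_lin_elt.
have le1 : (\rank (chi_eigenspace l) <= \rank (rop rV (redC \o iso_elt i l)))%N.
  apply: mxrankS; have -> : chi_eigenspace l = (a * #[x]%:R)^-1 *: chi_eigenspace l *m rop rV (redC \o iso_elt i l).
    have -> : rop rV (redC \o iso_elt i l) = irr_op i *m rop rV (redC \o lin_elt l).
      rewrite -ropM; apply: eq_bigr => y Yy; congr (_ *: _); rewrite /=.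
      by apply: redC_conv => z; [apply: Aint_irr_elt | apply: Aint_lin_elt].
    rewrite Da mul_scalar_mx -scalemxAl -scalemxAr eig_rop (scalerA a) scalerA.
    by rewrite mulVf ?scale1r // mulf_neq0 ?order_neq0.
  by rewrite submxMl.
apply: leq_trans (leq_mul (leqnn d) le1) _.
apply: leq_trans (mxrank_rop _ absV) _.
pose B := rmx Y (algint_of \o iso_elt i l).
have -> : rmx Y (redC \o iso_elt i l) = map_mx red B.
  by apply/matrixP=> u v; rewrite !mxE.
have -> : rmx Y (iso_elt i l) = map_mx algint_val B.
  by apply/matrixP=> u v; rewrite !mxE /= algint_ofK.
exact: (@mxrank_map_le _ _ _ (\val : {rmorphism algint -> algC}) red _ B val_inj).
Qed.

Lemma sum_irr_mult (i : Iirr Y) : \sum_(l : Iirr <[x]>) irr_mult i l = chi_deg i.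
Proof.
apply/eqP; rewrite -eqC_nat natr_sum chi_degE.
rewrite -(cfRes1 <[x]> 'chi_i) (cfun_sum_cfdot ('Res[<[x]>] 'chi_i)) sum_cfunE.
apply/eqP/eq_bigr => l _; by rewrite cfunE lin_char1 // mulr1 irr_multE.
Qed.

(** Summing [eig_le] over l gives d * d <= degree * degree. *)
Lemma le_degree i : irr_op i != 0 -> (d <= chi_deg i)%N.
Proof.
move=> nzi; have le1 : (d <= \sum_(l : Iirr <[x]>) \rank (chi_eigenspace l))%N.
  rewrite -{1}(mxrank1 F d); apply: leq_trans (mxrankS sum_eig) _.
  exact: mxrank_sum_leqif.
have deg0 : (0 < chi_deg i)%N by rewrite -ltC_nat chi_degE irr1_gt0.
have H : (d * \sum_(l : Iirr <[x]>) \rank (chi_eigenspace l) <= chi_deg i * chi_deg i)%N.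
  rewrite -{2}(sum_irr_mult i) !big_distrr; apply: leq_sum => l _; exact: eig_le.
by rewrite -leq_sqr -!mulnn (leq_trans _ H) // leq_mul.
Qed.

(** Each term of the sum is bounded by [eig_le], and the totals are equal. *)
Lemma rank_eig i (l : Iirr <[x]>) : irr_op i != 0 -> d = chi_deg i ->
  \rank (chi_eigenspace l) = irr_mult i l.
Proof.
move=> nzi di; have le (l' : Iirr <[x]>) : (\rank (chi_eigenspace l') <= irr_mult i l')%N.
  by have := eig_le l' nzi; rewrite -[chi_deg i]di leq_pmul2l ?d_gt0.
have le1 : (\sum_(l : Iirr <[x]>) irr_mult i l <= \sum_(l : Iirr <[x]>) \rank (chi_eigenspace l))%N.
  rewrite sum_irr_mult -di -{1}(mxrank1 F d); apply: leq_trans (mxrankS sum_eig) _.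
  exact: mxrank_sum_leqif.
exact: (leq_sum_eq le le1).
Qed.

Lemma eig_direct i : irr_op i != 0 -> d = chi_deg i ->
  mxdirect (\sum_(l : Iirr <[x]>) chi_eigenspace l).
Proof.
move=> nzi di; apply/mxdirectP; rewrite /=.
rewrite (eq_bigr _ (fun l _ => rank_eig l nzi di)) sum_irr_mult -di.
apply/eqP; rewrite eqn_leq rank_leq_row /= -{1}(mxrank1 F d).
exact/mxrankS/sum_eig.
Qed.

End OneElement.
End OneRep.
End Lift.

Section Degrees.

Variables (F : closedFieldType) (red : {rmorphism algint -> F}).
Variables (gT : finGroupType) (Y : {group gT}).
Hypothesis F'Y : [pchar F]^'.-group Y.

Lemma rop_gring d (rV : mx_representation F Y d) a :
  rop rV a = gring_mx rV (\row_k a (enum_val k)).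
Proof.
rewrite /gring_mx /= mulmx_sum_row linear_sum /rop big_enum_val.
by apply: eq_bigr => k _; rewrite linearZ /= rowK mxvecK mxE.
Qed.

(** The group algebra of a group of order prime to the characteristic is
semisimple, so its elements are determined by their action on the irreducible
modules. *)
Lemma gring_mx_irr_eq0 (sG : irrType F Y) b :
  (forall j : sG, gring_mx (irr_repr j) b = 0) -> b = 0.
Proof.
move=> b0; rewrite -(gring_mxK b); set A := gring_mx _ b.
suffices -> : A = 0 by rewrite linear0.
have RA : (A \in group_ring F Y)%MS by apply: gring_mxP.
rewrite -[A]mulmx1 -(Wedderburn_sum_id_pchar sG F'Y) mulmx_sumr big1 // => j _.
have Rj : (Wedderburn_id j \in Wedderburn_subring j)%MS by apply: Wedderburn_id_mem.
apply/eqP; rewrite -mxvec_eq0 -submx0.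
rewrite -(ker_irr_comp_op_pchar sG F'Y (socle_irr j)) irr_reprK_pchar // sub_capmx.
have idealR := Wedderburn_ideal j.
rewrite (submx_trans (mem_mulsmx RA Rj)) /=; last by case/andP: idealR.
apply/sub_kermxP; rewrite mul_vec_lin /=.
have Re : (Wedderburn_id j \in group_ring F Y)%MS.
  by rewrite -(Wedderburn_sum_pchar sG F'Y) (sumsmx_sup j).
by rewrite -(gring_rowK Re) gring_opJ /A gring_op_mx b0 mul0mx linear0.
Qed.

Local Notation irr_op := (irr_op red).

(** The coefficient at 1 of [irr_elt i] is the square of the degree of i, which
divides #|Y| and so does not vanish in F. *)
Lemma irr_op_surj (sG : irrType F Y) i : exists j : sG, irr_op (irr_repr j) i != 0.
Proof.
apply/existsP; apply: contraT; rewrite negb_exists => /forallP e0.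
have /rowP/(_ (enum_rank_in (group1 Y) 1%g)) : \row_k redC red (irr_elt i (enum_val k)) = 0 :> 'rV_#|Y|.
  apply: (@gring_mx_irr_eq0 sG) => j.
  apply: etrans (esym (rop_gring (irr_repr j) (redC red \o irr_elt i))) _.
  by apply/eqP; rewrite -[_ == _]negbK.
rewrite !mxE enum_rankK_in // /irr_elt invg1 => r0.
have /dvdCP[c Zc] := dvd_irr1_cardG i => /(congr1 (redC red)).
have Ac : c \in Aint by apply: Aint_Cint.
have A1 : 'chi_i 1%g \in Aint by apply: Aint_irr.
rewrite redC_nat redCM // => E; have /eqP[] := natY_neq0 F'Y.
move: r0; rewrite redCM // => /eqP; rewrite mulf_eq0 orbb => /eqP r0.
by rewrite E r0 mulr0.
Qed.

Lemma irr_op_rsim d d' (rV : mx_representation F Y d) (rW : mx_representation F Y d') i :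
  mx_rsim rV rW -> irr_op rV i = 0 -> irr_op rW i = 0.
Proof.
case/mx_rsim_sym/mx_rsim_def=> f [f' _ homf] e0.
rewrite /irr_op /rop (eq_bigr (fun y => f *m (redC red (irr_elt i y) *: rV y) *m f')).
  by rewrite -mulmx_suml -mulmx_sumr [X in _ *m X *m _]e0 mulmx0 mul0mx.
by move=> y Yy; rewrite homf // -scalemxAr -scalemxAl.
Qed.

(** By [irr_op_surj] and a count of the classes of Y, every irreducible module
corresponds to exactly one i.  The degrees compare by [le_degree], and their
squares have the same sum #|Y|. *)
Lemma irr_op_degree d (rV : mx_representation F Y d) i :
  mx_irreducible rV -> irr_op rV i != 0 -> d = chi_deg i.
Proof.
move=> irrV nzi; pose sG : irrType F Y := DecSocleType (regular_repr F Y).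
have split_Y : group_splitting_field F Y by apply: group_closure_closed_field.
(* Injective since a module determines its i, hence bijective by counting. *)
pose g i := xchoose (irr_op_surj sG i); have nzg i' : irr_op (irr_repr (g i')) i' != 0 := xchooseP (irr_op_surj sG i').
have inj_g : injective g.
  move=> i1 i2 g12; have nz2 : irr_op (irr_repr (g i1)) i2 != 0 by rewrite g12 nzg.
  exact: (irr_op_uniq (socle_irr (g i1)) (nzg i1) nz2).
have bij_g : bijective g.
  apply: (inj_card_bij inj_g).
  by rewrite card_irr_pchar // card_ord NirrE.
have deg_g i' : irr_degree (g i') = chi_deg i'.
  have le_sq i1 : (irr_degree (g i1) ^ 2 <= chi_deg i1 ^ 2)%N.
    rewrite leq_sqr; have := @le_degree _ red _ Y F'Y _ (irr_repr (g i1)) (socle_irr (g i1)) 1%g (group1 Y) i1.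
    exact.
  apply/eqP; rewrite -eqn_sqr; apply/eqP; move: i'; apply: (leq_sum_eq le_sq).
  have <- : (\sum_(j : sG) irr_degree j ^ 2 = \sum_i irr_degree (g i) ^ 2)%N.
    by rewrite (reindex g) //; apply: onW_bij.
  rewrite sum_irr_degree_pchar // -leC_nat natr_sum -irr_sum_square.
  rewrite le_eqVlt; apply/orP; left; apply/eqP/eq_bigr => i1 _.
  by rewrite natrX chi_degE.
have rsimV := rsim_irr_comp_pchar sG F'Y irrV.
have [g' g'K gK] := bij_g; set j := irr_comp sG rV in rsimV.
have di : d = irr_degree j by case: rsimV.
suffices Di : i = g' j by rewrite di -[j]gK -Di deg_g.
apply: (irr_op_uniq irrV nzi); apply: contra_neq (nzg (g' j)); rewrite gK.
exact: irr_op_rsim.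
Qed.

End Degrees.

Section LiftSimilar.

Variables (F : closedFieldType) (red : {rmorphism algint -> F}).
Variables (gT : finGroupType) (Y : {group gT}).
Hypothesis F'Y : [pchar F]^'.-group Y.

(** The multiplicity of the eigenvalue attached to a character of <[x]> is its
multiplicity in the restriction of 'chi_i, hence is invariant under the
automorphism u; a bijection of the eigenspaces carrying the one of l to the one
of its transform intertwines x and x ^+ k. *)
Lemma lift_similar d (rV : mx_representation F Y d) : mx_irreducible rV ->
  exists i : Iirr Y, forall k, coprime k #|Y| -> pow_stable i k ->
  {in Y, forall x, exists2 T, T \in unitmx & T *m rV (x ^+ k)%g = rV x *m T}.
Proof.
move=> irrV; have [i nzi] := irr_op_exists red F'Y irrV; exists i => k co_k st_k x Yx.
have di := irr_op_degree F'Y irrV nzi.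
have [u Du] := Qn_aut_exists co_k; rewrite (pow_stable_aut i Du) in st_k.
have sxY : <[x]> \subset Y by rewrite cycle_subG.
have lin_x (l : Iirr <[x]>) : 'chi_l \is a linear_char.
  exact/irr_cyclic_lin/cycle_cyclic.
pose A (l : Iirr <[x]>) : 'M[F]_d := chi_eigenspace red rV (aut_Iirr u l).
have bij_aut : bijective (aut_Iirr u : Iirr <[x]> -> Iirr <[x]>).
  exact/injF_bij/aut_Iirr_inj.
have sumE : (\sum_(l : Iirr <[x]>) chi_eigenspace red rV l :=: 1%:M)%MS.
  by apply/eqmxP; rewrite submx1 sum_eig.
have sumA : (\sum_l A l = \sum_(l : Iirr <[x]>) chi_eigenspace red rV l)%MS.
  by rewrite [RHS](reindex (aut_Iirr u)) //; apply: onW_bij.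
have rankA l : \rank (A l) = \rank (chi_eigenspace red rV l).
  rewrite !(rank_eig F'Y irrV Yx _ nzi di).
  apply/eqP; rewrite -eqC_nat !irr_multE aut_IirrE.
  have -> : 'Res[<[x]>] 'chi_i = cfAut u ('Res[<[x]>] 'chi_i).
    by rewrite cfAutRes (eqP st_k).
  rewrite cfdot_aut_char ?irr_char // cfAutRes (eqP st_k).
  by rewrite -irr_multE rmorph_nat.
have dirA : mxdirect (\sum_l A l).
  apply/mxdirectP; rewrite /= sumA (mxdirectP (eig_direct F'Y irrV Yx nzi di)) /=.
  by apply: eq_bigr => l _; rewrite rankA.
have sumA1 : (\sum_l A l :=: 1%:M)%MS by rewrite sumA.
have [T uT HT] := blocks_unitmx dirA sumE rankA.
exists T => //; apply: (eq_on_blocks sumA1) => l.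
have xk : (x ^+ k)%g \in <[x]> by rewrite mem_cycle.
have eigT : A l *m T *m rV (x ^+ k)%g = redC red ('chi_l (x ^+ k)%g) *: (A l *m T).
  have: (A l *m T <= chi_eigenspace red rV l)%MS by rewrite HT.
  by case/submxP=> D ->; rewrite -mulmxA (eig_cycle _ _ Yx) // -scalemxAr.
rewrite mulmxA eigT mulmxA (eig_cycle _ _ Yx) ?cycle_id // -scalemxAl.
congr (redC red _ *: _); rewrite aut_IirrE cfunE Du; last first.
  by rewrite -lin_charX ?cycle_id // (eqP (_ : x ^+ #|Y| == 1)%g) ?lin_char1 // -order_dvdn order_dvdG.
by rewrite lin_charX ?cycle_id.
Qed.

End LiftSimilar.

(** * Similarity of powers in a solvable group *)

Section Transport.

Variables (F : fieldType) (gT : finGroupType) (G H : {group gT}) (n : nat).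
Variables (rG : mx_representation F G n) (sHG : H \subset G) (U : 'M[F]_n).
Hypothesis modU : mxmodule (subg_repr rG sHG) U.
Local Notation rU := (submod_repr modU).

Lemma similar_expg (B : 'M[F]_n) x k j : x \in G ->
  B *m rG (x ^+ k)%g = rG x *m B ->
  B *m rG ((x ^+ j) ^+ k)%g = rG (x ^+ j)%g *m B.
Proof.
move=> Gx Bx; elim: j => [|j IHj].
  by rewrite expg0 expg1n repr_mx1 mulmx1 mul1mx.
rewrite expgSr expgMn; last exact/commute_sym/commuteX.
by rewrite !repr_mxM ?groupX // mulmxA IHj -!mulmxA Bx.
Qed.

(** [in_submod] projects onto U, so that this operator acts as B on U. *)
Definition submod_extend (B : 'M[F]_(\rank U)) : 'M[F]_n :=
  in_submod U 1%:M *m B *m val_submod 1%:M.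

Lemma submod_extendE B m (w : 'M_(m, n)) :
  w *m submod_extend B = val_submod (in_submod U w *m B).
Proof.
rewrite [RHS]val_submodE [in_submod U w]in_submodE /submod_extend.
by move: (val_submod _) (in_submod _ _) => V J; rewrite !mulmxA.
Qed.

Lemma submod_extend_id B : B \in unitmx -> (U *m submod_extend B :=: U)%MS.
Proof.
move=> uB; rewrite submod_extendE; apply/eqmxP/andP; split; first exact: val_submodP.
rewrite -{1}(in_submodK (submx_refl U)) val_submodS.
suffices : row_full (in_submod U U *m B) by apply: submx_full.
by rewrite /row_full mxrankMfree ?row_free_unit // mxrank_in_submod.
Qed.

Lemma submod_extend_similar B t k m (w : 'M_(m, n)) : t \in H -> (w <= U)%MS ->
    B *m rU (t ^+ k)%g = rU t *m B ->
  w *m rG t *m submod_extend B = w *m submod_extend B *m rG (t ^+ k)%g.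
Proof.
move=> Ht wU Bt; rewrite !submod_extendE.
have := val_submodJ modU (in_submod U w *m B) (groupX k Ht) => /= <-.
have := in_submodJ modU t wU => /= ->.
congr (val_submod _); rewrite -(mulmxA _ _ B) -(mulmxA _ B). by congr (_ *m _); apply: esym.
Qed.

End Transport.

Section Main.

Variables (F : closedFieldType) (red : {rmorphism algint -> F}) (p : nat).
Hypothesis charFp : p \in [pchar F].
Variable gT : finGroupType.

(** Every M :&: G comes with an inclusion in G, so that the condition on normal
subgroups becomes a boolean. *)
Definition all_homogeneous (G : {group gT}) n (rG : mx_representation F G n) :=
  [forall M : {group gT}, (M :&: G <| G) ==>
    [forall W : DecSocleType (subg_repr rG (subsetIr M G)), row_full W]].

Lemma all_homogeneousP (G : {group gT}) n (rG : mx_representation F G n) :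
  mx_irreducible rG -> all_homogeneous rG ->
  forall N : {group gT}, N <| G -> homogeneous_on rG N.
Proof.
move=> irrG /forallP homG N nsNG; have := homG N.
have EN : (N :&: G)%G = N by apply/val_inj/setIidPl/normal_sub.
move: (subsetIr N G); rewrite -[(N :&: G)%g]/(gval (N :&: G)%G) EN => s1.
rewrite nsNG => /forallP fullW sNG; rewrite (bool_irrelevance sNG s1).
have s1E := bool_irrelevance s1 (normal_sub nsNG).
have irr' := irrG; rewrite s1E in fullW *.
have /imsetP[W _ _] := Clifford_atrans irrG (DecSocleType (subg_repr rG (normal_sub nsNG))).
exists (socle_base W); first exact: socle_simple.
by rewrite sub1mx fullW.
Qed.

(** A p-regular element is conjugate to an element of the Hall p'-subgroup Y. *)
Lemma homogeneous_similar (G : {group gT}) n (rG : mx_representation F G n) :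
    solvable G -> mx_irreducible rG ->
    (forall N : {group gT}, N <| G -> homogeneous_on rG N) ->
  exists2 g, g \in G & forall k, coprime k #|G| -> k = 1 %[mod #[g]] ->
    {in G, forall x, p^'.-elt x ->
      exists2 T, T \in unitmx & T *m rG (x ^+ k)%g = rG x *m T}.
Proof.
move=> solG irrG homG; have [Y hallY] := Hall_exists p^' solG.
have sYG := pHall_sub hallY.
have irrY := Hall_irr charFp solG hallY homG irrG sYG.
have F'Y : [pchar F]^'.-group Y.
  by rewrite (eq_pgroup _ (eq_negn (pcharf_eq charFp))) (pHall_pgroup hallY).
have [i Hi] := lift_similar red F'Y irrY.
have [g Yg Hg] := Feit_irr i (solvableS sYG solG).
exists g => [|k co_k k1 x Gx p'x]; first exact: (subsetP sYG).
have co_kY : coprime k #|Y| by apply: coprime_dvdr co_k; apply: cardSg.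
have sxG : <[x]> \subset G by rewrite cycle_subG.
have [z] := Hall_Jsub solG hallY sxG p'x.
rewrite -[z]invgK -cycleJ cycle_subG groupV; move: (z^-1)%g => {}z Gz Yx.
have [T uT HT] := Hi k co_kY (Hg k co_kY k1) _ Yx.
exists (rG z^-1%g *m T *m rG z).
  by rewrite !unitmx_mul uT !repr_mx_unit ?groupV.
have {HT} HT : T *m rG ((x ^ z^-1) ^+ k)%g = rG (x ^ z^-1)%g *m T by [].
have Ex y : (y = z^-1 * (y ^ z^-1) * z)%g by rewrite conjgE invgK !mulgA mulVg mul1g mulgKV.
rewrite [in RHS](Ex x) (Ex (x ^+ k)%g) conjXg.
have Gy : (x ^ z^-1)%g \in G by rewrite groupJ ?groupV.
move: (x ^ z^-1)%g Gy HT => y Gy HT.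
rewrite !repr_mxM ?groupM ?groupX ?groupV // !mulmxA repr_mxK //.
by rewrite -(mulmxA _ T) HT !mulmxA repr_mxK.
Qed.

End Main.

Section Main.

Variables (F : closedFieldType) (red : {rmorphism algint -> F}) (p : nat).
Hypothesis charFp : p \in [pchar F].
Variable gT : finGroupType.

(** In the inductive case W0 is a homogeneous component for the normal subgroup
K, and H is its stabiliser, which acts irreducibly on W0 by Clifford's theorem.
The stabiliser of a component W in <[x]> is cyclic, so that it is enough to
transport to W the similarity given by induction for a generator. *)
Lemma Feit_similar n (G : {group gT}) (rG : mx_representation F G n) :
    solvable G -> mx_irreducible rG ->
  exists2 g, g \in G & forall k, coprime k #|G| -> k = 1 %[mod #[g]] ->
    {in G, forall x, p^'.-elt x ->
      exists2 T, T \in unitmx & T *m rG (x ^+ k)%g = rG x *m T}.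
Proof.
have [m] := ubnP n; elim: m => // m IHm in n G rG *; rewrite ltnS => lenm solG irrG.
have [homG | ] := boolP (all_homogeneous rG).
  by apply: (homogeneous_similar red charFp solG irrG); apply: all_homogeneousP.
rewrite negb_forall => /existsP[M]; rewrite negb_imply => /andP[nsKG].
rewrite negb_forall => /existsP[/=].
set K := (M :&: G)%G; set sKG := subsetIr M G.
have -> : sKG = normal_sub (nsKG : K <| G) by apply: bool_irrelevance.
set sH := DecSocleType _ => W0 ltW0.
have rkW0 : (\rank W0 < n)%N by rewrite ltn_neqAle ltW0 rank_leq_row.
pose to := Clifford_action sH.
pose H := rstabs_group rG W0; have sHG : H \subset G := rstabs_sub rG W0.
have [modW0 nz0 simW0] := Clifford_rstabs_simple irrG W0.
have irrH : mx_irreducible (submod_repr modW0) by apply/submod_mx_irr.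
have [g Hg IHg] := IHm _ _ _ (leq_trans rkW0 lenm) (solvableS sHG solG) irrH.
exists g => [|k co_k k1 x Gx p'x]; first exact: (subsetP sHG).
have co_x : coprime k #[x] by apply: coprime_dvdr co_k; apply: order_dvdG.
have dirW := Socle_direct sH.
have sumW : (Socle sH :=: 1%:M)%MS by rewrite Clifford_Socle1.
apply: (block_similar dirW sumW (to := to)) => // [W y Gy | W].
  by apply: eqmx_sym; apply: val_Clifford_act.
have /imsetP[W1 _ EW1] := Clifford_atrans irrG sH.
have : W \in orbit to G W0.
  have : W0 \in orbit to G W1 by rewrite -EW1 inE.
  by move/(orbit_in_eqP (subxx G)) => ->; rewrite -EW1 inE.
case/orbitP=> h Gh Wh.
have WE : (W :=: W0 *m rG h)%MS by rewrite -Wh; apply: val_Clifford_act.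
have hVE : (W *m rG h^-1%g :=: W0)%MS.
  by rewrite -(repr_mxK rG Gh (m := n) W0); apply: eqmxMr.
have cycC : cyclic 'C_(<[x]>)[W | to] by apply: cyclicS (subsetIl _ _) (cycle_cyclic x).
have [z Cz] := cyclicP cycC.
have : z \in 'C_(<[x]>)[W | to] by rewrite Cz cycle_id.
case/setIP=> xz; have Gz : z \in G by apply: subsetP xz; rewrite cycle_subG.
rewrite !inE sub1set inE => /andP[_ /eqP zW].
have zWE : (W *m rG z :=: W)%MS.
  by apply: eqmx_sym; rewrite -{1}zW; apply: val_Clifford_act.
have Gs : (z ^ h^-1)%g \in G by rewrite groupJ ?groupV.
have Hs : (z ^ h^-1)%g \in H.
  rewrite inE Gs conjgE invgK !repr_mxM ?groupM ?groupV // !mulmxA.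
  by rewrite /= -(eqmxMr _ (eqmxMr _ WE)) (eqmxMr _ zWE) hVE.
have p's : p^'.-elt (z ^ h^-1)%g by rewrite p_eltJ; apply: mem_p_elt p'x xz.
have co_kH : coprime k #|H| by apply: coprime_dvdr co_k; apply: cardSg.
have [B uB HB] := IHg k co_kH k1 _ Hs p's.
exists (rG h^-1%g *m submod_extend B *m rG h); split.
  rewrite mulmxA (mulmxA (socle_val W)).
  apply: eqmx_trans (eqmxMr _ (eqmxMr _ hVE)) _.
  exact: eqmx_trans (eqmxMr _ (submod_extend_id uB)) (eqmx_sym WE).
move=> y xy yW.
have : y \in <[z]>.
  rewrite -Cz inE xy !inE sub1set inE yW eqxx andbT.
  by apply: subsetP xy; rewrite cycle_subG.
case/cycleP=> j Dy.
have := similar_expg (rG := submod_repr modW0) j Hs HB.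
have -> : ((z ^ h^-1) ^+ j = y ^ h^-1)%g by rewrite -conjXg Dy.
have Hy : (y ^ h^-1)%g \in H by rewrite Dy conjXg groupX.
move=> Bt; have wU : (W *m rG h^-1%g <= W0)%MS by rewrite hVE.
have := submod_extend_similar Hy wU Bt.
have Gy : (y ^ h^-1)%g \in G by apply: (subsetP sHG).
have Eyk : (y ^+ k = h^-1 * (y ^ h^-1) ^+ k * h)%g.
  by rewrite -conjXg conjgE invgK !mulgA mulVg mul1g mulgKV.
have Ey : (y = h^-1 * (y ^ h^-1) * h)%g.
  by rewrite conjgE invgK !mulgA mulVg mul1g mulgKV.
move: (y ^ h^-1)%g Gy Ey Eyk => t Gt Ey -> E; rewrite Ey.
move: (submod_extend B) (socle_val W) E => C w E.
rewrite !repr_mxM ?groupM ?groupX ?groupV // !mulmxA.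
by rewrite !(repr_mxK rG Gh) E.
Qed.

End Main.

(** * The residue field is algebraically closed *)

Lemma Aint_integral z : z \in Aint -> integralOver (intr : int -> algC) z.
Proof.
rewrite unfold_in => /floorpP[q Dq]; exists q.
  have := minCpoly_monic z; rewrite Dq !monicE lead_coef_map_inj //; last exact: intr_inj.
  by rewrite -[1]/(1%:~R) eqr_int.
rewrite -Dq; exact: root_minCpoly.
Qed.

(** Integrality over the integers is transitive. *)
Lemma Aint_root_monic (q : {poly algC}) z :
  q \is monic -> root q z -> {in q : seq algC, forall c, c \in Aint} -> z \in Aint.
Proof.
move=> mon_q qz Aq; have [r mon_r rz] : integralOver (intr : int -> algC) z.
  by apply: integral_root_monic mon_q qz _ => c /Aq; apply: Aint_integral.
apply: root_monic_Aint rz _ _; first exact: monic_map.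
by apply/polyOverP=> i; rewrite coef_map /= intr_int.
Qed.

(** The closed field structure is laid over the given field structure, so that
modules need not be transported. *)
Lemma closed_fieldE (F : fieldType) : GRing.closed_field_axiom F ->
  exists K : closedFieldType, (K : fieldType) = F.
Proof.
case: F => S c ax; pose M := Field_isAlgClosed.Build (GRing.Field.Pack c) ax.
by exists (HB.pack_for closedFieldType S c M).
Qed.

Section Residue.

Variables (F : fieldType) (red : {rmorphism algint -> F}).
Hypothesis red_surj : forall a : F, exists z : algint, red z = a.

(** A monic polynomial lifts to one with coefficients in the algebraic
integers, whose complex roots are algebraic integers. *)
Lemma residue_closed : GRing.closed_field_axiom F.
Proof.
move=> n P n_gt0; have /fin_all_exists[a Da] (i : 'I_n) := red_surj (P i).
pose b (i : nat) : algC := if @insub _ _ 'I_n i is Some j then algint_val (a j) else 0.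
have bE (i : 'I_n) : b i = algint_val (a i) by rewrite /b valK.
pose q : {poly algC} := 'X^n - \poly_(i < n) b i.
have szq : (size (\poly_(i < n) b i) <= n)%N by apply: size_poly.
have mon_q : q \is monic.
  by rewrite monicE lead_coefDl ?lead_coefXn // size_polyXn size_polyN ltnS.
have sz_q : size q = n.+1 by rewrite size_polyDl size_polyXn // size_polyN ltnS.
have [|x qx] := closed_rootP q _; first by rewrite sz_q eqSS -lt0n.
have Ax : x \in Aint.
  apply: Aint_root_monic mon_q qx _ => c /(nthP 0)[i _ <-].
  rewrite coefB coefXn coef_poly rpredB ?rpred_nat //.
  by case: ifP => [lt_in|_]; rewrite ?rpred0 // (bE (Ordinal lt_in)) algintP.
exists (redC red x); rewrite -redCX //.
have -> : x ^+ n = \sum_(i < n) algint_val (a i) * x ^+ i.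
  apply/eqP; rewrite -subr_eq0; move: qx; rewrite /root /q hornerD hornerXn hornerN.
  rewrite horner_poly; congr (_ - _ == 0); apply: eq_bigr => i _.
  by rewrite bE.
rewrite redC_sum => [|i _]; last by rewrite rpredM ?rpredX ?algintP.
apply: eq_bigr => i _; rewrite redCM ?rpredX ?algintP // redCX //.
by rewrite {1}/redC algint_of_val Da.
Qed.

End Residue.

(** * Eigenvalues of p-regular elements *)

Lemma char_poly_similar (F : fieldType) n (T A B : 'M[F]_n) :
  T \in unitmx -> T *m A = B *m T -> char_poly A = char_poly B.
Proof.
move=> uT TA; pose C := map_mx polyC T.
have CA : C *m char_poly_mx A = char_poly_mx B *m C.
  by rewrite /char_poly_mx mulmxBr mulmxBl scalar_mxC -!map_mxM TA.
have nzC : \det C != 0 by rewrite det_map_mx polyC_eq0 -unitfE -unitmxE.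
by apply: (mulIf nzC); rewrite -[RHS]det_mulmx -CA det_mulmx mulrC.
Qed.

Lemma char_poly_diag (F : fieldType) n (d : 'rV[F]_n) :
  char_poly (diag_mx d) = \prod_(a <- [seq d 0 i | i : 'I_n]) ('X - a%:P).
Proof.
rewrite char_poly_trig ?diag_mx_is_trig // big_image /=.
by apply: eq_bigr => i _; rewrite mxE eqxx.
Qed.

Lemma algint_valM y z : algint_val (y * z) = algint_val y * algint_val z.
Proof. exact: (rmorphM (\val : {rmorphism algint -> algC})). Qed.

Lemma algint_valX z k : algint_val (z ^+ k) = algint_val z ^+ k.
Proof. exact: (rmorphXn (\val : {rmorphism algint -> algC})). Qed.

Section Spectrum.

Variables (F : closedFieldType) (red : {rmorphism algint -> F}) (p : nat).
Hypothesis charFp : p \in [pchar F].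
Variables (gT : finGroupType) (G : {group gT}) (n : nat).
Variables (rG : mx_representation F G n) (x : gT).
Hypotheses (Gx : x \in G) (p'x : p^'.-elt x).

(** A p-regular element is diagonalisable: the group <[x]> has order prime to
the characteristic, and the eigenspaces attached to its characters span. *)
Lemma char_poly_expg (s : seq F) k : char_poly (rG x) = \prod_(a <- s) ('X - a%:P) ->
  char_poly (rG (x ^+ k)%g) = \prod_(a <- s) ('X - (a ^+ k)%:P).
Proof.
move=> Ds; have sxG : <[x]> \subset G by rewrite cycle_subG.
have F'x : [pchar F]^'.-group <[x]> by rewrite (eq_pgroup _ (eq_negn (pcharf_eq charFp))).
have sum1 := sum_eig red F'x (subg_repr rG sxG) (cycle_id x).
pose rs := undup [seq redC red ('chi_l x) | l : Iirr <[x]>].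
have [P uP] : diagonalizable (rG x).
  apply/diagonalizablePeigen; exists rs; first exact: undup_uniq.
  apply/eqmxP; rewrite submx1; apply: submx_trans sum1 _; apply/sumsmx_subP=> l _.
  have ls : redC red ('chi_l x) \in rs by rewrite mem_undup image_f.
  by rewrite (bigD1_seq _ ls (undup_uniq _)) /= addsmxSl.
case/similar_diagPex=> d /(similarP uP) Dd.
have Ddk : P *m rG (x ^+ k)%g = diag_mx (map_mx (fun a => a ^+ k) d) *m P.
  elim: k => [|k IHk].
    rewrite expg0 repr_mx1 mulmx1; apply/matrixP=> i j.
    by rewrite mul_diag_mx !mxE expr0 mul1r.
  rewrite expgSr repr_mxM ?groupX // mulmxA IHk -mulmxA Dd mulmxA.
  congr (_ *m _); apply/matrixP=> i j; rewrite mul_diag_mx !mxE exprSr.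
  by case: (i == j); rewrite ?mulr1n ?mulr0n ?mulr0.
have : perm_eq s [seq d 0 i | i : 'I_n].
  by apply: prod_XsubC_eq; rewrite -Ds (char_poly_similar uP Dd) char_poly_diag.
move/(perm_map (fun a => a ^+ k)) => sd.
rewrite (char_poly_similar uP Ddk) char_poly_diag.
rewrite -(big_map (fun a => a ^+ k) xpredT (fun a => 'X - a%:P)) (perm_big _ sd) /=.
by rewrite -map_comp; congr (\prod_(a <- _) _); apply: eq_map => i; rewrite !mxE.
Qed.

(** If z <> 1 and z ^+ m = 1, then the sum of the first m powers of z vanishes;
its reduction is m, which is not divisible by p. *)
Lemma red_regular_root (z : algint) : pregular_root p (algint_val z) -> red z = 1 -> z = 1.
Proof.
case=> m p'm zm rz; apply/val_inj/eqP; rewrite -subr_eq0; apply: contraNT p'm => nz.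
rewrite (dvdn_pcharf charFp).
have sum0 : \sum_(j < m) z ^+ j = 0.
  apply/val_inj/(mulfI nz); rewrite rmorph0 mulr0 rmorph_sum.
  have := subrX1 (algint_val z) m; rewrite zm subrr => E.
  by rewrite [RHS]E; congr (_ * _); apply: eq_bigr => j _; rewrite rmorphXn.
have := congr1 red sum0; rewrite rmorph_sum rmorph0 => s0.
rewrite -[X in _ == X]s0 (eq_bigr (fun=> 1)) ?sumr_const ?card_ord // => j _.
by rewrite rmorphXn rz expr1n.
Qed.

Section Lifts.
Variable s : seq algint.
Hypotheses (reg_s : {in s, forall z : algint, pregular_root p (algint_val z)})
  (char_s : char_poly (rG x) = \prod_(z <- s) ('X - (red z)%:P)).

Lemma lift_root_order z : z \in s -> algint_val z ^+ #[x] = 1.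
Proof.
move=> sz; have : root (char_poly (rG x)) (red z).
  rewrite char_s -(big_map red xpredT (fun a => 'X - a%:P)) root_prod_XsubC.
  exact: map_f.
rewrite -eigenvalue_root_char => /eigenvalueP[v vx nzv].
have vxj j : v *m rG (x ^+ j)%g = red z ^+ j *: v.
  elim: j => [|j IHj]; first by rewrite expg0 repr_mx1 mulmx1 scale1r.
  by rewrite expgSr exprSr repr_mxM ?groupX // mulmxA IHj -scalemxAl vx scalerA.
have := vxj #[x]; rewrite expg_order repr_mx1 mulmx1 => /eqP.
rewrite -[X in X == _]scale1r -subr_eq0 -scalerBl scaler_eq0 (negPf nzv) orbF.
rewrite subr_eq0 => /eqP/esym; rewrite -rmorphXn => /red_regular_root zx.
have {}zx : z ^+ #[x] = 1.
  apply: zx; have [m p'm zm] := reg_s sz; exists m => //.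
  by rewrite algint_valX exprAC zm expr1n.
by have := congr1 algint_val zx; rewrite algint_valX.
Qed.

(** The reductions of the lifts and of their k-th powers agree as multisets, and
reduction is injective on the roots of unity involved. *)
Lemma char_poly_pow_stable k : coprime k #[x] ->
    (exists2 T, T \in unitmx & T *m rG (x ^+ k)%g = rG x *m T) ->
  \sum_(z <- s) algint_val z ^+ k = \sum_(z <- s) algint_val z.
Proof.
move=> co_k [T uT Tx].
pose q := map (fun z : algint => z ^+ k) s.
have inj_red : {in s ++ q &, injective red}.
  have ord_sq z : z \in s ++ q -> algint_val z ^+ #[x] = 1.
    rewrite mem_cat => /orP[/lift_root_order // | /mapP[y /lift_root_order ys ->]].
    by rewrite algint_valX exprAC ys expr1n.
  move=> y z /ord_sq yx /ord_sq zx ryz.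
  have x_gt0 := order_gt0 x.
  have zV : z * z ^+ #[x].-1 = 1 by apply: val_inj; rewrite -exprS prednK // [LHS]algint_valX.
  suffices yz1 : y * z ^+ #[x].-1 = 1 by rewrite -[y]mulr1 -zV mulrCA yz1 mulr1.
  apply: red_regular_root; last by rewrite rmorphM ryz -rmorphM zV rmorph1.
  exists #[x].
    by rewrite -p'natE ?(pcharf_prime charFp).
  by rewrite algint_valM algint_valX exprMn yx mul1r exprAC zx expr1n.
have perm_red : perm_eq (map red q) (map red s).
  apply: prod_XsubC_eq; rewrite !big_map -char_s -(char_poly_similar uT Tx).
  rewrite (@char_poly_expg (map red s)) ?big_map //.
  by apply: eq_bigr => z _; rewrite rmorphXn.
pose g a := nth 0 (s ++ q) (index a (map red (s ++ q))).
have gK : {in s ++ q, cancel red g}.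
  move=> z sz; have rz : red z \in map red (s ++ q) by apply: map_f.
  have lt_i : (index (red z) (map red (s ++ q)) < size (s ++ q))%N.
    by rewrite -(size_map red) index_mem.
  by apply: inj_red => //; rewrite ?mem_nth // -(nth_map _ 0) // nth_index.
have gKmap t : {subset t <= s ++ q} -> map g (map red t) = t.
  by move=> st; rewrite -map_comp map_id_in // => z tz; rewrite /= gK ?st.
have pqs : perm_eq q s.
  have := perm_map g perm_red; rewrite !gKmap // => z zt; rewrite mem_cat zt ?orbT //.
rewrite -[RHS](perm_big _ pqs) big_map /=.
by apply: eq_bigr => z _; rewrite algint_valX.
Qed.

End Lifts.
End Spectrum.

(** * Cyclotomic fields *)

Lemma Qadjoin_dvd n N (z Z y : algC) : n.-primitive_root z -> N.-primitive_root Z ->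
  (n %| N)%N -> Qadjoin (fun t => t = z) y -> Qadjoin (fun t => t = Z) y.
Proof.
move=> pz pZ nN Qy K clK KZ; apply: Qy => // _ ->.
pose Kp : divringClosed algC := HB.pack K (GRing.isDivringClosed.Build _ K clK).
have [i ->] : {i : 'I_N | z = Z ^+ i}.
  by apply: (prim_rootP pZ); rewrite -(divnK nN) mulnC exprM (prim_expr_order pz) expr1n.
by apply: (@rpredX _ Kp); apply: KZ.
Qed.

(** The elements on which two automorphisms agree form a field. *)
Lemma cyclotomic_aut_eq (u v : {rmorphism algC -> algC}) n y : cyclotomic_field n y ->
  (forall z, z ^+ n = 1 -> u z = v z) -> u y = v y.
Proof.
case=> z pz Qy uv; pose K := [pred t | u t == v t].
suffices /eqP : y \in K by [].
apply: Qy => [|_ ->]; last by rewrite inE uv ?(prim_expr_order pz).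
split=> [|a b|a b]; rewrite !inE; first by rewrite !rmorph1.
  by move=> /eqP ua /eqP ub; rewrite !rmorphB ua ub.
by move=> /eqP ua /eqP ub; rewrite !fmorph_div ua ub.
Qed.

(** Galois correspondence in the N-th cyclotomic field. *)
Lemma cyclotomic_fixed N m y : (0 < N)%N -> (m %| N)%N -> cyclotomic_field N y ->
    (forall k (u : {rmorphism algC -> algC}), coprime k N -> k = 1 %[mod m] ->
      (forall z, z ^+ N = 1 -> u z = z ^+ k) -> u y = y) ->
  cyclotomic_field m y.
Proof.
case: N => // N _ mN [Z pZ Qy] fix_y.
have [Qn galQ [QnC gQnC [w [pw genw] _]]] := group_num_field_exists [set: 'I_N.+1].
rewrite cardsT card_ord in pw.
have pQw : N.+1.-primitive_root (QnC w) by rewrite fmorph_primitive_root.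
have [y0 Dy] : exists y0, y = QnC y0.
  have [CtoQn CtoQn0 QnCK] := num_field_proj QnC.
  pose K := [pred t | QnC (CtoQn t) == t].
  have KP t : reflect (exists a, t = QnC a) (t \in K).
    by apply: (iffP eqP) => [<- | [a ->]]; [exists (CtoQn t) | rewrite QnCK].
  apply/KP; apply: (Qadjoin_dvd pZ pQw (dvdnn _) Qy) => [|_ ->]; last by apply/KP; exists w.
  split=> [|_ _ /KP[a ->] /KP[b ->]|_ _ /KP[a ->] /KP[b ->]]; apply/KP.
  - by exists 1; rewrite rmorph1.
  - by exists (a - b); rewrite rmorphB.
  by exists (a / b); rewrite fmorph_div.
pose v := w ^+ (N.+1 %/ m); have pv : m.-primitive_root v := dvdn_prim_root pw mN.
pose K := <<1; v>>%AS.
have galK : galois K {:Qn} by apply: galoisS galQ; rewrite sub1v subvf.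
have Ky : y0 \in K.
  rewrite -(galois_fixedField galK); apply/fixedFieldP; first exact: memvf.
  move=> s Ks; have K1 : s \in 'Gal({:Qn} / 1) by apply: subsetP Ks; rewrite galS ?sub1v.
  have [i Di] : {i : 'I_N.+1 | s w = w ^+ i}.
    by apply: (prim_rootP pw); rewrite -rmorphXn (prim_expr_order pw) rmorph1.
  have co_i : coprime i N.+1.
    by rewrite -(prim_root_exp_coprime _ pw) -Di fmorph_primitive_root.
  have i1 : i = 1 %[mod m].
    apply/eqP; rewrite -(eq_prim_root_expr pv) expr1 -{2}(fixed_gal (subvf K) Ks (memv_adjoin _ _)).
    by rewrite /v rmorphXn /= Di -!exprM mulnC.
  have [u Du] := gQnC s.
  have := fix_y i u co_i i1; rewrite Dy => fix_i.
  apply: (fmorph_inj QnC); have /= -> := Du y0; apply: fix_i => z zN.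
  have [j ->] := prim_rootP pQw zN.
  have /= Dw := Du w.
  by rewrite rmorphXn -Dw [s w]Di rmorphXn exprAC.
exists (QnC v); first by rewrite fmorph_primitive_root.
move=> L clL Lv; pose Lp : divringClosed algC := HB.pack L (GRing.isDivringClosed.Build _ L clL).
have /Fadjoin_polyP[q Qq Dq] := Ky.
rewrite Dy Dq -horner_map; apply: (@rpred_horner _ Lp); last exact: Lv.
apply/polyOverP=> i; rewrite coef_map /=.
have /vlineP[c ->] := polyOverP Qq i.
by rewrite -in_algE -[QnC _]/((QnC \o in_alg Qn) c) fmorph_eq_rat; apply: (rpred_rat Lp).
Qed.

(** An exponent k which is 1 modulo gcdn a b agrees modulo b with an exponent h
which is 1 modulo a.  The automorphism of h fixes the a-th field, and the one
of k agrees with it on the b-th field. *)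
Lemma cyclotomic_gcd a b y : (0 < a)%N -> (0 < b)%N ->
  cyclotomic_field a y -> cyclotomic_field b y -> cyclotomic_field (gcdn a b) y.
Proof.
move=> a_gt0 b_gt0 Qa Qb; have ab_gt0 : (0 < a * b)%N by rewrite muln_gt0 a_gt0.
have dab : (gcdn a b %| a * b)%N by rewrite dvdn_mulr ?dvdn_gcdl.
have Qab : cyclotomic_field (a * b) y.
  have [Z pZ] := C_prim_root_exists ab_gt0; exists Z => //; have [z pz Qz] := Qa.
  exact: (Qadjoin_dvd pz pZ (dvdn_mulr _ (dvdnn a)) Qz).
apply: (cyclotomic_fixed ab_gt0 dab Qab) => k u co_k k1 Du.
have [h [ha hb]] : exists h, h = 1 %[mod a] /\ h = k %[mod b].
  have [k0 | k_gt0] := posnP k.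
    move: co_k; rewrite k0 /coprime gcd0n muln_eq1 => /andP[_ /eqP->].
    by exists 1; rewrite !modn1.
  have [s t Dst _] := egcdnP b a_gt0.
  move/eqP: k1; rewrite eqn_mod_dvd // => /dvdnP[e De].
  exists (1 + s * a * e)%N; split; first by rewrite mulnAC addnC modnMDl.
  rewrite Dst mulnDl [(gcdn a b * e)%N]mulnC -De addnCA subnKC //.
  by rewrite mulnAC modnMDl.
have co_h : coprime h (a * b).
  rewrite coprimeMr -coprime_modl ha coprime_modl coprime1n /=.
  by rewrite -coprime_modl hb coprime_modl; move: co_k; rewrite coprimeMr => /andP[].
have [v Dv] := Qn_aut_exists co_h.
have expr_modn (z : algC) i n : z ^+ n = 1 -> z ^+ (i %% n) = z ^+ i.
  by move=> zn; rewrite [in RHS](divn_eq i n) exprD mulnC exprM zn expr1n mul1r.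
have -> : u y = v y.
  apply: (cyclotomic_aut_eq Qb) => z zb.
  have zab : z ^+ (a * b) = 1 by rewrite mulnC exprM zb expr1n.
  by rewrite Du // Dv // -(expr_modn _ _ _ zb) -hb expr_modn.
apply: (cyclotomic_aut_eq (v := idfun) Qa) => z za.
have zab : z ^+ (a * b) = 1 by rewrite exprM za expr1n.
by rewrite Dv // -(expr_modn _ _ _ za) ha expr_modn.
Qed.

(** * The Feit number *)

Lemma values_in_cyclotomicP (T : Type) (phi : T -> algC) d : (0 < d)%N ->
  values_in_cyclotomic phi d <-> forall x, cyclotomic_field d (phi x).
Proof.
move=> d_gt0; split=> [val_d x | val_d y Qy].
  by apply: val_d => K clK; apply; exists x.
have [Z pZ] := C_prim_root_exists d_gt0; exists Z => // K clK KZ; apply: Qy => // _ [x ->].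
have [z pz Qz] := val_d x; exact: (Qadjoin_dvd pz pZ (dvdnn d) Qz clK KZ).
Qed.

Section FeitNumber.

Variables (T : finType) (phi : T -> algC) (s : T -> seq algC) (N m : nat).
Hypotheses (N_gt0 : (0 < N)%N) (mN : (m %| N)%N).
Hypothesis phiE : forall x, phi x = \sum_(z <- s x) z.
Hypothesis sN : forall x, {in s x, forall z, z ^+ N = 1}.
Hypothesis stable_m : forall k x, coprime k N -> k = 1 %[mod m] ->
  \sum_(z <- s x) z ^+ k = \sum_(z <- s x) z.

Let fixed d := [forall x : T, forall k : 'I_N,
  coprime k N ==> (k == 1 %[mod d]) ==> (\sum_(z <- s x) z ^+ k == phi x)].

Let aut_phi (u : {rmorphism algC -> algC}) k x :
  (forall z, z ^+ N = 1 -> u z = z ^+ k) -> u (phi x) = \sum_(z <- s x) z ^+ k.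
Proof.
by move=> Du; rewrite phiE rmorph_sum; apply: eq_big_seq => z /sN/Du.
Qed.

Let fixedP d : (d %| N)%N -> fixed d <-> forall x, cyclotomic_field d (phi x).
Proof.
move=> dN; split=> [/forallP fix_d x | cyc_d].
  apply: (cyclotomic_fixed N_gt0 dN) => [|k u co_k k1 Du].
    have [Z pZ] := C_prim_root_exists N_gt0; exists Z => // K clK KZ.
    pose Kp : divringClosed algC := HB.pack K (GRing.isDivringClosed.Build _ K clK).
    rewrite phiE big_seq; apply: (@rpred_sum _ Kp) => z /sN/(prim_rootP pZ)[i ->].
    by apply: (@rpredX _ Kp); apply: KZ.
  rewrite (aut_phi x Du); pose k' := Ordinal (ltn_pmod k N_gt0).
  have /forallP/(_ k')/= := fix_d x; rewrite coprime_modl co_k /=.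
  rewrite (modn_dvdm _ dN) k1 eqxx => /eqP <-.
  apply: eq_big_seq => z /sN zN.
  by rewrite [in LHS](divn_eq k N) exprD mulnC exprM zN expr1n mul1r.
apply/forallP=> x; apply/forallP=> k; apply/implyP=> co_k; apply/implyP=> /eqP k1.
have [u Du] := Qn_aut_exists co_k; rewrite -(aut_phi x Du).
apply/eqP; apply: (cyclotomic_aut_eq (v := idfun) (cyc_d x)) => z zd /=.
have zN : z ^+ N = 1 by rewrite -(divnK dN) mulnC exprM zd expr1n.
rewrite Du // (divn_eq k d) k1 exprD mulnC exprM zd expr1n mul1r.
by rewrite -[RHS]expr1 [in RHS](divn_eq 1 d) exprD mulnC exprM zd expr1n mul1r.
Qed.

(** All values lie in the N-th cyclotomic field, so the least f may be sought
among the divisors of N, where membership is decidable in terms of the power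
maps. *)
Lemma Feit_number_exists : exists2 f, (f %| m)%N & is_Feit_number phi f.
Proof.
have fix_m : (m %| N)%N && fixed m.
  rewrite mN; apply/forallP=> x; apply/forallP=> k; apply/implyP=> co_k.
  by apply/implyP=> /eqP k1; rewrite phiE stable_m.
have [f /andP[fN fix_f] min_f] := ex_minnP (ex_intro (fun d => (d %| N)%N && fixed d) m fix_m).
have f_gt0 : (0 < f)%N by apply: dvdn_gt0 fN.
have m_gt0 : (0 < m)%N by apply: dvdn_gt0 mN.
have gcd_fix a b : (0 < a)%N -> (b %| N)%N -> (forall x, cyclotomic_field a (phi x)) ->
    fixed b -> (f <= gcdn a b)%N.
  move=> a_gt0 bN cyc_a fix_b; apply: min_f.
  have dN : (gcdn a b %| N)%N by apply: dvdn_trans (dvdn_gcdr a b) bN.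
  rewrite dN; apply/(fixedP dN) => x; apply: cyclotomic_gcd => //.
    exact: dvdn_gt0 bN.
  by move: x; apply/(fixedP bN).
have cyc_f := (fixedP fN).1 fix_f.
exists f.
  have := gcd_fix f m f_gt0 mN cyc_f (andP fix_m).2.
  move=> le_f; suffices <- : gcdn f m = f by apply: dvdn_gcdr.
  by apply/eqP; rewrite eqn_leq le_f dvdn_leq ?dvdn_gcdl.
split=> // [|n n_gt0 /(values_in_cyclotomicP _ n_gt0) cyc_n].
  exact/(values_in_cyclotomicP _ f_gt0).
have cyc_N : forall x, cyclotomic_field N (phi x).
  move=> x; have := cyc_f x.
  case=> z pz Qz; have [Z pZ] := C_prim_root_exists N_gt0; exists Z => //.
  exact: (Qadjoin_dvd pz pZ fN Qz).
have fix_N := (fixedP (dvdnn N)).2 cyc_N.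
apply: leq_trans (gcd_fix n N n_gt0 (dvdnn N) cyc_n fix_N) _.
by rewrite dvdn_leq ?dvdn_gcdl.
Qed.

End FeitNumber.

Lemma Feit_Brauer_closed (p : nat) (F : closedFieldType) (charF : p \in [pchar F])
    (red : {rmorphism algint -> F})
    (gT : finGroupType) (G : {group gT}) (solG : solvable G)
    (phi : pregular p G -> algC) (phi_IBr : IBr red phi) :
  exists2 g : gT, g \in G & is_Feit_number phi #[g]%g.
Proof.
have [n [rG [irrG aff]]] := phi_IBr.
have [g Gg Hg] := Feit_similar red charF solG irrG.
have [s Hs] := fin_all_exists aff.
pose sC x := map algint_val (s x).
have phiE x : phi x = \sum_(z <- sC x) z by rewrite big_map; case: (Hs x).
have sN x : {in sC x, forall z, z ^+ #|G| = 1}.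
  move=> _ /mapP[z sz ->]; have [reg_s char_s _] := Hs x.
  have /andP[Gx p'x] := valP x.
  have zx := lift_root_order charF Gx reg_s char_s sz.
  by rewrite -(divnK (order_dvdG Gx)) mulnC exprM zx expr1n.
have stable k x : coprime k #|G| -> k = 1 %[mod #[g]] ->
    \sum_(z <- sC x) z ^+ k = \sum_(z <- sC x) z.
  move=> co_k k1; rewrite !big_map; have [reg_s char_s _] := Hs x.
  have /andP[Gx p'x] := valP x.
  have co_x : coprime k #[val x] by apply: coprime_dvdr co_k; apply: order_dvdG.
  apply: (char_poly_pow_stable charF Gx p'x reg_s char_s co_x).
  exact: Hg.
have [f fg Ff] := Feit_number_exists (cardG_gt0 G) (order_dvdG Gg) phiE sN stable.
exists (g ^+ (#[g] %/ f))%g; first by rewrite groupX.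
rewrite orderXdiv ?dvdn_div //; have f_gt0 : (0 < f)%N by case: Ff.
by rewrite divnA // mulKn.
Qed.

Theorem mainTheorem2 (p : nat) (p_prime : prime p)
    (F : fieldType) (charF : p \in [pchar F])
    (red : {rmorphism algint -> F})
    (red_surj : forall a : F, exists z : algint, red z = a)
    (gT : finGroupType) (G : {group gT}) (solG : solvable G)
    (phi : pregular p G -> algC) (phi_IBr : IBr red phi) :
  exists2 g : gT, g \in G & is_Feit_number phi #[g]%g.
Proof.
have [K EK] := closed_fieldE (residue_closed red_surj).
case: F / EK in charF red red_surj phi_IBr *.
exact: (Feit_Brauer_closed charF solG phi_IBr).
Qed.
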